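(* For any $n\ge 1$ and any integers $d_1,\ldots,d_n\ge 1$, the multidimensional resultant is given by $$\mathrm{Res}_{d_1,\ldots,d_n}=\sum_{A\in \mathrm{REF}^{(1)}} r_A\ \mathbf{a}^A ,$$ where, for all $A\in\mathrm{REF}^{(1)}$, $$r_A=\sum_{\mathcal{B}}\ \prod_{\ell=1}^{n-1}\ \prod_{w\in \mathrm{Word}^{(\ell)}} \mathcal{W}^{(\ell)}\left(B_{w}^{(\ell)};\ B_{w1}^{(\ell+1)},B_{w2}^{(\ell+1)},\ldots,B_{wd_\ell}^{(\ell+1)}\right).$$ Here $\mathrm{Word}^{(\ell)}:=[d_1]\times\cdots\times[d_{\ell-1}]$ (so $\mathrm{Word}^{(1)}=\{\varnothing\}$ consists of the empty word only), for $w\in\mathrm{Word}^{(\ell)}$ and $j\in[d_\ell]$ the word $wj\in\mathrm{Word}^{(\ell+1)}$ is obtained by appending the letter $j$ at the end of $w$, and the sum is over all collections $\mathcal{B}=(B_w^{(\ell)})_{1\le \ell\le n,\ w\in\mathrm{Word}^{(\ell)}}$ such that $B_w^{(\ell)}\in\mathrm{REF}^{(\ell)}$ for all $\ell\in[n]$ and all $w\in\mathrm{Word}^{(\ell)}$, and $B^{(1)}_{\varnothing}=A$.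
   Context: Conventions: $\mathbb{N}=\{0,1,2,\ldots\}$; $[q]=\{1,\ldots,q\}$; for $\alpha=(\alpha_1,\ldots,\alpha_n)$, $|\alpha|=\alpha_1+\cdots+\alpha_n$; $e_1,\ldots,e_n$ is the standard basis of $\mathbb{Z}^n$; $\mathbf{1}\{P\}$ equals $1$ if $P$ holds and $0$ otherwise (a term whose indicator factor vanishes is $0$). Empty products are $1$. Resultant. Let $F_i=\sum_{|\alpha|=d_i}a_{i,\alpha}x^\alpha$, $1\le i\le n$, be generic homogeneous forms in $x_1,\ldots,x_n$ with formal coefficients $a_{i,\alpha}$. $\mathrm{Res}_{d_1,\ldots,d_n}$ is the unique polynomial in the $a_{i,\alpha}$ such that, over $\mathbb{C}$: (A1) it vanishes iff $F_1,\ldots,F_n$ have a common zero in $\mathbb{C}^n\setminus\{0\}$; (A2) for each $i$, it is homogeneous of degree $\prod_{j\ne i}d_j$ in the coefficients of $F_i$; (A3) it equals $1$ when $F_i=x_i^{d_i}$ for all $i$. Fillings. Let $\mathbb{D}=\{(i,\alpha): i\in[n],\ \alpha\in\mathbb{N}^n,\ |\alpha|=d_i\}$. A filling is a map $A:\mathbb{D}\to\mathbb{Z}$, $(i,\alpha)\mapsto A_{i,\alpha}$; it is effective if its values are in $\mathbb{N}$. For effective $A$, $\mathbf{a}^A=\prod_{(i,\alpha)\in\mathbb{D}}a_{i,\alpha}^{A_{i,\alpha}}$. Put $\mathrm{Row}_i(A)=\sum_{\alpha}A_{i,\alpha}$, $\mathrm{Row}(A)=(\mathrm{Row}_1(A),\ldots,\mathrm{Row}_n(A))^{T}$,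 $\|A\|=\sum_{(i,\alpha)\in\mathbb{D}}A_{i,\alpha}$, $\mathrm{wt}(A)=\sum_{(i,\alpha)\in\mathbb{D}}A_{i,\alpha}\,\alpha\in\mathbb{Z}^n$, $\mathrm{supp}(A)=\{(i,\alpha):A_{i,\alpha}\ne0\}$. $A\le B$ is the cellwise inequality, $AB$ is the cellwise product, and for $\mathbb{S}\subset\mathbb{D}$, $\mathbf{1}_{\mathbb{S}}$ is the filling equal to $1$ on $\mathbb{S}$ and $0$ elsewhere. For $\rho\in\mathbb{N}^n$ and an effective filling $B$ with $\mathrm{Row}(B)=\rho$, $$\begin{bmatrix}\rho\\ B\end{bmatrix}:=\frac{\prod_{i=1}^n\rho_i!}{\prod_{(i,\alpha)\in\mathbb{D}}B_{i,\alpha}!}.$$ Relative objects. For $\ell\in[n]$ let $\mathbb{D}^{(\ell)}=\{(i,\alpha)\in\mathbb{D}:\ \ell\le i\le n,\ \alpha_1=\cdots=\alpha_{\ell-1}=0\}$; $\delta^{(\ell)}=(\delta^{(\ell)}_1,\ldots,\delta^{(\ell)}_n)^T$ with $\delta_i^{(\ell)}=0$ for $i<\ell$ and $\delta_i^{(\ell)}=\prod_{\ell\le j\le n,\ j\ne i}d_j$ for $\ell\le i\le n$; $\mathrm{REF}^{(\ell)}$ is the set of effective fillings $B:\mathbb{D}\to\mathbb{N}$ with $\mathrm{supp}(B)\subset\mathbb{D}^{(\ell)}$, $\mathrm{Row}(B)=\delta^{(\ell)}$ and $\mathrm{wt}(B)=d_\ell\cdots d_n\,(e_\ell+e_{\ell+1}+\cdots+e_n)$;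 $\mathrm{FRR}^{(\ell)}=\{B\in\mathrm{REF}^{(\ell)}: B_{\ell,d_\ell e_\ell}=\delta^{(\ell)}_\ell\}$. For $1\le\ell\le n-1$ let $\mathbb{E}^{(\ell)}=\{(i,d_ie_i):\ell\le i\le n\}$ and $\mathbb{T}^{(\ell)}=\{(i,(d_i-1)e_\ell+e_{i+1}):\ell\le i<n\}\cup\{(n,d_ne_\ell)\}$. For $A$ effective with $\mathrm{supp}(A)\subset\mathbb{D}^{(\ell)}$ define the filling $P^{(\ell)}(A)$ by $[P^{(\ell)}(A)]_{i,\alpha}=\mathrm{Row}_i(A)\,\mathbf{1}\{(i,\alpha)\in\mathbb{T}^{(\ell)}\}$, and set $\mathcal{Z}^{(\ell)}(A)=\|\mathbf{1}_{\mathbb{D}^{(\ell)}\setminus(\mathbb{E}^{(\ell)}\cup\mathbb{T}^{(\ell)})}A\|$. For $A,B\in\mathrm{REF}^{(\ell)}$, write $A\prec^{(\ell)}B$ iff ($A\in\mathrm{FRR}^{(\ell)}$ and $B\notin\mathrm{FRR}^{(\ell)}$) or ($A,B\notin\mathrm{FRR}^{(\ell)}$ and $\mathcal{Z}^{(\ell)}(A)<\mathcal{Z}^{(\ell)}(B)$). For $A\in\mathrm{REF}^{(\ell)}\setminus\mathrm{FRR}^{(\ell)}$ and $\widetilde A\in\mathrm{REF}^{(\ell)}$, $$\mathcal{T}^{(\ell)}(A,\widetilde A)=\mathbf{1}\left\{\mathbf{1}_{\mathbb{D}^{(\ell)}\setminus\mathbb{E}^{(\ell)}}\widetilde A\le\mathbf{1}_{\mathbb{D}^{(\ell)}\setminus\mathbb{E}^{(\ell)}}A+P^{(\ell)}(\mathbf{1}_{\mathbb{E}^{(\ell)}}A)\right\}(-1)^{\|\mathbf{1}_{\mathbb{E}^{(\ell)}}A\|+\|\mathbf{1}_{\mathbb{E}^{(\ell)}}\widetilde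 A\|+1}\begin{bmatrix}\mathrm{Row}(\mathbf{1}_{\mathbb{E}^{(\ell)}}\widetilde A)\\ \mathbf{1}_{\mathbb{D}^{(\ell)}\setminus\mathbb{E}^{(\ell)}}(A-\widetilde A)+P^{(\ell)}(\mathbf{1}_{\mathbb{E}^{(\ell)}}A)\end{bmatrix}.$$ For $A\in\mathrm{REF}^{(\ell)}$, $B\in\mathrm{FRR}^{(\ell)}$, $$\mathcal{C}^{(\ell)}(A,B)=\mathbf{1}\{A\in\mathrm{FRR}^{(\ell)},A=B\}+\mathbf{1}\{A\notin\mathrm{FRR}^{(\ell)}\}\sum_{k\ge0}\ \sum_{\widetilde A_1,\ldots,\widetilde A_k}\mathbf{1}\{B\prec^{(\ell)}\widetilde A_k\prec^{(\ell)}\cdots\prec^{(\ell)}\widetilde A_1\prec^{(\ell)}A\}\ \mathcal{T}^{(\ell)}(A,\widetilde A_1)\mathcal{T}^{(\ell)}(\widetilde A_1,\widetilde A_2)\cdots\mathcal{T}^{(\ell)}(\widetilde A_k,B),$$ where the inner sum is over $\widetilde A_1,\ldots,\widetilde A_k\in\mathrm{REF}^{(\ell)}\setminus\mathrm{FRR}^{(\ell)}$ (for $k=0$ the term is $\mathcal{T}^{(\ell)}(A,B)$); the sum over $k$ has finitely many nonzero terms. For $A\in\mathrm{REF}^{(\ell)}$ and $B_1,\ldots,B_{d_\ell}\in\mathrm{REF}^{(\ell+1)}$, $$\mathcal{W}^{(\ell)}(A;B_1,\ldots,B_{d_\ell})=\sum_{B\in\mathrm{FRR}^{(\ell)}}\mathbf{1}\{B_1+\cdots+B_{d_\ell}=\mathbf{1}_{\mathbb{D}^{(\ell+1)}}B\}\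 \mathcal{C}^{(\ell)}(A,B).$$ *)

(* Defs.v *)
From HB Require Import structures.
From mathcomp Require Import all_boot all_order all_algebra.
From mathcomp Require Import reals.
From mathcomp Require Import complex mpoly.

Set Implicit Arguments.
Unset Strict Implicit.
Unset Printing Implicit Defensive.

Import Order.TTheory GRing.Theory Num.Theory.

Local Open Scope ring_scope.

(** All indices are 0-based: for [i : 'I_n] the form F_{i+1} has degree [d i],
    the level l of the code is the level l+1 of the text (so REF^(1) is
    [REF 0]), and the letters of a word at position i are 0, ..., d i - 1. *)

Section Cells.
Variables (n : nat) (d : 'I_n -> nat).

(** The set D of pairs (i, alpha) with |alpha| = d i; the bound on the degree
    only serves to make the type of exponents finite. *)
Definition cell := {i : 'I_n & {m : 'X_{1..n < (d i).+1} | mdeg m == d i}}.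

Definition row_of (c : cell) : 'I_n := tag c.
Definition expo (c : cell) : 'X_{1..n} := val (val (tagged c)).

(** The basis vector e_k, and 0 when k >= n. *)
Definition evec (k : nat) : 'X_{1..n} := [multinom (j == k :> nat) : nat | j < n].

End Cells.

Section Resultant.
Variables (R : realType) (n : nat) (d : 'I_n -> nat).

Local Notation N := #|{: cell d}|.

(** The form F_i whose coefficients are the numbers a_(i, alpha). *)
Definition form (a : cell d -> R[i]) (i : 'I_n) : {mpoly R[i][n]} :=
  \sum_(c : cell d | row_of c == i) a c *: 'X_[expo c].

(** A polynomial in the coefficients has one variable for each cell, the cell c
    being the variable of index [enum_rank c]. *)
Definition eval_coef (p : {mpoly R[i][N]}) (a : cell d -> R[i]) : R[i] :=
  p.@[fun k => a (enum_val k)].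

Definition common_zero (a : cell d -> R[i]) : Prop :=
  exists x : 'I_n -> R[i],
    (exists j, x j != 0) /\ forall i, (form a i).@[x] = 0.

Definition row_homogeneous (p : {mpoly R[i][N]}) (i : 'I_n) (e : nat) : Prop :=
  forall m, m \in msupp p ->
    (\sum_(c : cell d | row_of c == i) m (enum_rank c) = e)%N.

Definition is_resultant (p : {mpoly R[i][N]}) : Prop :=
  [/\ forall a : cell d -> R[i], eval_coef p a = 0 <-> common_zero a,
      forall i, row_homogeneous p i (\prod_(j | j != i) d j)
    & forall a : cell d -> R[i],
        (forall i, form a i = 'X_i ^+ d i) -> eval_coef p a = 1].

End Resultant.

Section Fillings.
Variables (n : nat) (d : 'I_n -> nat).
Local Notation cell := (cell d).

Definition filling := {ffun cell -> int}.

Definition effective (A : filling) : bool := [forall c, 0 <= A c].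

Definition frow (A : filling) (i : 'I_n) : int :=
  \sum_(c : cell | row_of c == i) A c.

Definition fnorm (A : filling) : int := \sum_(c : cell) A c.

Definition fwt (A : filling) (j : 'I_n) : int :=
  \sum_(c : cell) A c * (expo c j)%:Z.

Definition fle (A B : filling) : bool := [forall c, A c <= B c].

(** The cellwise product of the indicator filling of S with A. *)
Definition mask (S : {set cell}) (A : filling) : filling :=
  [ffun c => (c \in S)%:R * A c].

(** The bracket [rho; B]; it is only meant for B effective with Row(B) = rho,
    which makes the absolute values harmless. *)
Definition bracket (rho : 'I_n -> int) (B : filling) : rat :=
  (\prod_(i < n) (`|rho i|%N)`!)%:R / (\prod_(c : cell) (`|B c|%N)`!)%:R.

Definition Dset (l : nat) : {set cell} :=
  [set c | (l <= row_of c)%N & [forall j : 'I_n, (j < l)%N ==> (expo c j == 0%N)]].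

Definition delta (l : nat) (i : 'I_n) : nat :=
  if (l <= i)%N then (\prod_(j < n | (l <= j)%N && (j != i)) d j)%N else 0%N.

Definition REF (l : nat) (B : filling) : bool :=
  [&& effective B,
      [forall c, (B c != 0) ==> (c \in Dset l)],
      [forall i, frow B i == (delta l i)%:Z]
    & [forall j : 'I_n, fwt B j ==
        (if (l <= j)%N then \prod_(k < n | (l <= k)%N) d k else 0)%N%:Z]].

(** The condition on B_(l, d_l e_l) is put on the unique cell (l, d_l e_l). *)
Definition FRR (l : nat) (B : filling) : bool :=
  REF l B && [forall c : cell,
    (row_of c == l :> nat) && (expo c == (evec n l *+ d (row_of c))%MM) ==>
      (B c == (delta l (row_of c))%:Z)].

Definition Eset (l : nat) : {set cell} :=
  [set c | (l <= row_of c)%N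
         & expo c == (evec n (row_of c) *+ d (row_of c))%MM].

Definition Tset (l : nat) : {set cell} :=
  [set c | (l <= row_of c)%N
         & expo c == if ((row_of c).+1 < n)%N
                     then (evec n l *+ (d (row_of c)).-1 + evec n (row_of c).+1)%MM
                     else (evec n l *+ d (row_of c))%MM].

Definition Pfill (l : nat) (A : filling) : filling :=
  [ffun c => frow A (row_of c) * (c \in Tset l)%:R].

Definition Zdeg (l : nat) (A : filling) : int :=
  fnorm (mask (Dset l :\: (Eset l :|: Tset l)) A).

Definition prec (l : nat) (A B : filling) : bool :=
  FRR l A && ~~ FRR l B || [&& ~~ FRR l A, ~~ FRR l B & Zdeg l A < Zdeg l B].

Definition Tcoef (l : nat) (A A' : filling) : rat :=
  let E := Eset l in
  let S := Dset l :\: E in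
  if fle (mask S A') (mask S A + Pfill l (mask E A)) then
    (-1) ^ (fnorm (mask E A) + fnorm (mask E A') + 1) *
    bracket (frow (mask E A')) (mask S (A - A') + Pfill l (mask E A))
  else 0.

(** The entries of a filling in REF are at most d_1 ... d_n (see [REF_bfilling]),
    so sums over REF range over the following finite type. *)
Definition bfilling := {ffun cell -> 'I_(\prod_(j < n) d j).+1}.

Definition fil (B : bfilling) : filling := [ffun c => (nat_of_ord (B c))%:Z].
Coercion fil : bfilling >-> filling.

Lemma REF_bfilling (l : nat) (A : filling) :
  (forall i, 0 < d i)%N -> REF l A -> exists B : bfilling, A = B.
Proof.
move=> d_gt0 /and4P[/forallP A_ge0 _ /forallP rowA _].
have delta_le i : (delta l i <= \prod_(j < n) d j)%N.
  rewrite /delta; case: ifP => _; last by [].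
  rewrite [leqRHS](bigID (fun j : 'I_n => (l <= j)%N && (j != i))) /=.
  by rewrite leq_pmulr // prodn_cond_gt0.
have A_le c : (`|A c| < (\prod_(j < n) d j).+1)%N.
  rewrite ltnS; apply: leq_trans (delta_le (row_of c)).
  rewrite -lez_nat gez0_abs // -(eqP (rowA (row_of c))) /frow.
  by rewrite (bigD1 c) //= lerDl sumr_ge0.
exists [ffun c => Ordinal (A_le c)]; apply/ffunP => c.
by rewrite !ffunE /= gez0_abs.
Qed.

Lemma chain_size (l : nat) (A : filling) (s : seq bfilling) :
  ~~ FRR l A -> all (fun X : bfilling => ~~ FRR l X) s ->
  path (fun X Y => prec l Y X) A (map fil s) -> (size s <= #|{: bfilling}|)%N.
Proof.
move=> nA ns pA; suff /card_uniqP <- : uniq s by apply: max_card.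
have prec_tr : transitive (fun X Y => prec l Y X).
  move=> Y X Z; rewrite /prec.
  case: (FRR l X); case: (FRR l Y); case: (FRR l Z) => //=.
  by move=> YX ZY; apply: lt_trans ZY YX.
have prec_irr : irreflexive (fun X Y => prec l Y X).
  by move=> X; rewrite /prec ltxx; case: (FRR l X).
by apply: (map_uniq (f := fil)); apply: sorted_uniq prec_tr prec_irr _ (path_sorted pA).
Qed.

(** The sum over the chains B < A_k < ... < A_1 < A; the elements of a chain are
    distinct (see [chain_size]), which bounds k. *)
Definition Ccoef (l : nat) (A B : filling) : rat :=
  if FRR l A then (A == B)%:R else
  \sum_(k < #|{: bfilling}|.+1)
   \sum_(s : k.-tuple bfilling |
          all (fun X : bfilling => REF l X && ~~ FRR l X) s)
     let t := rcons (map fil s) B in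
     if path (fun X Y => prec l Y X) A t
     then \prod_(x <- pairmap (Tcoef l) A t) x else 0.

Definition Wcoef (l : 'I_n) (A : filling) (Bs : 'I_(d l) -> filling) : rat :=
  \sum_(B : bfilling | FRR l B)
    if \sum_(j < d l) Bs j == mask (Dset l.+1) B then Ccoef l A B else 0.

(** Word^(l+1) = [d_1] x ... x [d_l], as the list of words of length l. *)
Definition words (l : nat) : seq (seq nat) :=
  foldl (fun ws i => [seq rcons w j | w <- ws, j <- iota 0 (d i)])
        [:: [::]] (take l (enum 'I_n)).

Lemma words_uniq (l : nat) : uniq (words l).
Proof.
rewrite /words.
have: uniq [:: [::] : seq nat] by [].
elim: (take l _) [:: [::]] => [|i r IH] //= ws ws_uniq; apply: IH.
apply: allpairs_uniq => //; first exact: iota_uniq.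
by case=> [w j] [w' j'] _ _ /= /rcons_inj [-> ->].
Qed.

Lemma mem_words (l : nat) (w : seq nat) : (l <= n)%N ->
  (w \in words l) =
  (size w == l) && [forall i : 'I_n, (i < l)%N ==> (nth 0%N w i < d i)%N].
Proof.
elim: l w => [|l IH] w l_le.
  rewrite /words take0 inE -size_eq0; case: eqP => //= _.
  by apply/esym/forallP.
have wordsS : words l.+1 =
    [seq rcons v j | v <- words l, j <- iota 0 (d (Ordinal l_le))].
  rewrite /words (take_nth (Ordinal l_le)) ?size_enum_ord // -cats1 foldl_cat /=.
  suff -> : nth (Ordinal l_le) (enum 'I_n) l = Ordinal l_le by [].
  by apply: val_inj; rewrite /= nth_enum_ord.
rewrite wordsS; apply/allpairsP/andP => [[[v j] [/=]]|[/eqP sz /forallP wd]].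
  rewrite IH 1?ltnW // mem_iota add0n => /andP[/eqP sz /forallP vd] j_lt ->.
  rewrite size_rcons sz; split=> //; apply/forallP => i; apply/implyP.
  rewrite ltnS leq_eqVlt nth_rcons sz => /orP[/eqP il|il].
    by rewrite il ltnn eqxx (_ : i = Ordinal l_le) //; apply: val_inj.
  by rewrite il; have /implyP := vd i; apply.
case/lastP: w sz wd => [//|v j]; rewrite size_rcons => -[sz] wd.
exists (v, j); split=> //=.
  rewrite IH 1?ltnW // sz eqxx; apply/forallP => i; apply/implyP => il.
  by have /implyP := wd i; rewrite nth_rcons sz il; apply; apply: ltnW.
by have /implyP := wd (Ordinal l_le); rewrite mem_iota nth_rcons sz ltnn eqxx; apply.
Qed.

(** The index set of the collections: all pairs of a level and a word of that
    level, the level being the length of the word. *)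
Definition nodes : seq (seq nat) := flatten [seq words l | l <- iota 0 n].

Definition collection := {ffun seq_sub nodes -> bfilling}.

(** The default value is irrelevant: only nodes are ever looked up. *)
Definition lookup (Bc : collection) (w : seq nat) : filling :=
  if insub w is Some u then fil (Bc u) else 0.

Definition rcoef (A : filling) : rat :=
  \sum_(Bc : collection |
         [forall w : seq_sub nodes, REF (size (val w)) (Bc w)]
         && (lookup Bc [::] == A))
    \prod_(l < n | (l.+1 < n)%N) \prod_(w <- words l)
      Wcoef (lookup Bc w) (fun j : 'I_(d l) => lookup Bc (rcons w j)).

End Fillings.

Section Monomials.
Variables (R : realType) (n : nat) (d : 'I_n -> nat).

Definition fmonom (A : filling d) : {mpoly R[i][#|{: cell d}|]} :=
  \prod_(c : cell d) 'X_(enum_rank c) ^+ `|A c|%N.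

End Monomials.

(* Main.v *)
Require Import Defs.
From HB Require Import structures.
From mathcomp Require Import all_boot all_order all_algebra.
From mathcomp Require Import reals.
From mathcomp Require Import complex mpoly.
From mathcomp Require Import boolp ring zify.

Set Implicit Arguments.
Unset Strict Implicit.
Unset Printing Implicit Defensive.

Import Order.TTheory GRing.Theory Num.Theory.
Local Open Scope ring_scope.

(** Why the formula holds.  Write F_1, .., F_n for the forms and call resultant
    of level l the resultant of the last n - l forms restricted to the subspace
    x_1 = .. = x_l = 0 (levels are counted from 0 here).  The formula unfolds a
    recursion expressing the coefficients of the resultant of level l through
    those of the resultant of level l + 1; three facts give it.

    Weights.  A univariate polynomial whose only possible zero is 0 is a
    monomial.  Applied along the orbits of one-parameter tori, which preserve
    the zero locus of the resultant, this shows that the resultant is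
    homogeneous for every such weight ([zero_weight]), so that only monomials
    given by fillings of REF occur ([res_REF], [res_expand]).

    Relations.  The forms whose pure coefficients are minus the sums of the
    other coefficients of their rows vanish at (0, .., 0, 1, .., 1), so the
    resultant vanishes on them identically ([res_vanishing]).  Comparing the
    coefficients of well-chosen monomials yields, for each A in REF outside FRR,
    the relation r_A = sum of T(A, A') r_A' over A' in REF different from A
    ([Tcoef_relation], [Tcoef_diag]).  Only fillings A' strictly below A
    contribute ([Tcoef_prec]): if A' and A agree outside the cells of E and T,
    the weights force their difference to be a multiple of a single filling,
    which is large enough to push A or A' into FRR ([comparison]).  Unrolling
    along chains gives r_A = sum of C(A, B) r_B over B in FRR ([coef_Ccoef]).

    Descent.  The coefficients r_B with B in FRR are those of the resultant in
    which the first form is the pure power y^d, where y = x_(l+1) is the first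
    variable of level l.  They are known once this
    specialisation is the d-th power of the resultant of the next level
    ([res_descent]), and this makes up most of the proof, because no theory of
    resultants is presupposed: the resultant of the next level has to be found
    as a polynomial d-th root.  Let q, Q_j and g_j be the values of the resultant
    when the first form is y^d, x_j^d and y x_j^(d-1), for j > l + 1.  Viewed as a function
    of linear factors of its first form, the resultant has a fixed finite set
    of zeros, and a polynomial in two variables with that property separates
    ([separated_variables]); hence q Q_j^(d-1) = g_j^d ([value_power]).  Around
    the pure powers this identity presents the power series root of q as g_j
    times a power series of Q_j, and Q_j is free of the coefficients of the
    monomials divisible by x_j.  So the root has bounded degree in those
    coefficients, for each j, hence bounded degree altogether: it is a
    polynomial ([polynomial_root]).

    Combining the three facts, r_A is the sum of W(A; B_1, .., B_d) times the
    product of the coefficients of the B_j at the next level ([coef_Wcoef]); at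
    the last level the only coefficient is 1 ([coef_last]).  Iterating and
    distributing products over sums gives the sum over collections
    ([tree_sum_step]). *)

(* The name mask alone denotes the selection of a subsequence by a bit sequence. *)
Local Notation fmask := Defs.mask.

(** * Polynomials without zeros along lines and torus orbits *)

Lemma base_expansion_inj n (b : nat) (f g : 'I_n -> nat) :
  (forall i, f i < b)%N -> (forall i, g i < b)%N ->
  (\sum_(i < n) f i * b ^ i = \sum_(i < n) g i * b ^ i)%N -> f =1 g.
Proof.
elim: n f g => [|n IH] f g fb gb; first by move=> _ [].
have split_digit (h : 'I_n.+1 -> nat) :
    (\sum_(i < n.+1) h i * b ^ i =
     (\sum_(i < n) h (lift ord0 i) * b ^ i) * b + h ord0)%N.
  rewrite big_ord_recl expn0 muln1 addnC big_distrl /=; congr addn.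
  by apply: eq_bigr => i _; rewrite /bump /= add1n expnSr mulnA.
rewrite !split_digit => E.
have b_gt0 : (0 < b)%N by apply: leq_ltn_trans (fb ord0).
have E0 : f ord0 = g ord0.
  by move/(congr1 (fun m => m %% b)%N): E; rewrite !modnMDl !modn_small.
have ET := IH (fun i => f (lift ord0 i)) (fun i => g (lift ord0 i)).
move=> i; case: (unliftP ord0 i) => [j ->|-> //]; apply: ET => //.
by move/eqP: E; rewrite E0 eqn_add2r eqn_pmul2r // => /eqP.
Qed.

Lemma horner_mmap (R : comNzRingType) n (h : 'I_n -> {poly R})
    (p : {mpoly R[n]}) t :
  (mmap polyC h p).[t] = p.@[fun i => (h i).[t]].
Proof.
rewrite /mmap horner_sum mevalE; apply: eq_bigr => m _.
by rewrite hornerM hornerC horner_prod; congr (_ * _); apply: eq_bigr => i _; rewrite horner_exp.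
Qed.

Section Points.
Variable C : numClosedFieldType.
Implicit Types n : nat.

Lemma poly_nat_roots0 (R : idomainType) (q : {poly R}) :
  injective (fun k => k%:R : R) -> (forall k, q.[k%:R] = 0) -> q = 0.
Proof.
move=> nat_inj q0; apply/eqP; apply/negPn/negP => qn0.
have := max_poly_roots qn0 (rs := [seq i%:R | i <- iota 0 (size q)]).
rewrite size_map size_iota ltnn => H; suff: false by []; apply: H.
  by apply/allP => _ /mapP[i _ ->]; apply/rootP.
by rewrite map_inj_uniq ?iota_uniq.
Qed.

Lemma poly_fun0 (q : {poly C}) : (forall t, q.[t] = 0) -> q = 0.
Proof. by move=> q0; apply: poly_nat_roots0 => // i j /eqP; rewrite eqr_nat => /eqP. Qed.

Lemma poly2_fun0 (q : {poly {poly C}}) : (forall s t, q.[t%:P].[s] = 0) -> q = 0.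
Proof.
move=> q0; apply: poly_nat_roots0 => [i j /(congr1 (coefp 0))|k].
  by rewrite !rmorph_nat => /eqP; rewrite eqr_nat => /eqP.
by apply: poly_fun0 => s; rewrite -(q0 s k%:R) rmorph_nat.
Qed.

(** Kronecker substitution: replacing the variable of index i by t^(b^i), for
    b larger than all exponents, keeps the monomials apart. *)
Lemma mpoly_fun0 n (p : {mpoly C[n]}) : (forall v, p.@[v] = 0) -> p = 0.
Proof.
move=> p0; pose b := msize p.
pose kr (m : 'X_{1..n}) := (\sum_(i < n) m i * b ^ i)%N.
have small (m : 'X_{1..n}) : m \in msupp p -> forall i, (m i < b)%N.
  move=> mp i; apply: leq_ltn_trans (msize_mdeg_lt mp).
  by rewrite mdegE (bigD1 i) //= leq_addr.
have kr_inj : {in msupp p &, injective kr}.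
  move=> m1 m2 m1p m2p E; apply/mnmP.
  by apply: base_expansion_inj E; apply: small.
pose q := mmap polyC (fun i => 'X^(b ^ i)) p.
have q0 : q = 0 by apply: poly_fun0 => t; rewrite horner_mmap.
have qE : q = \sum_(m <- msupp p) p@_m *: 'X^(kr m).
  rewrite /q /mmap; apply: eq_bigr => m _; rewrite mul_polyC; congr (_ *: _).
  by rewrite /mmap1 /kr expr_sum; apply: eq_bigr => i _; rewrite -exprM mulnC.
apply/mpolyP => m; rewrite mcoeff0; case: (boolP (m \in msupp p)) => [mp|];
  last exact: memN_msupp_eq0.
have := congr1 (fun r : {poly C} => r`_(kr m)) q0; rewrite qE coef0 coef_sum.
rewrite (bigD1_seq m) ?msupp_uniq //= coefZ coefXn eqxx mulr1.
rewrite big_seq_cond big1 ?addr0 // => m' /andP[m'p m'm].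
by rewrite coefZ coefXn (inj_in_eq kr_inj) // eq_sym (negPf m'm) mulr0.
Qed.

Lemma mpoly_neq0_point n (p : {mpoly C[n]}) : p != 0 -> exists v, p.@[v] != 0.
Proof.
move=> pn0; apply: contrapT => H; move/eqP: pn0; apply; apply: mpoly_fun0 => v.
by apply/eqP/negPn/negP => pv; apply: H; exists v.
Qed.

Lemma mpoly_eq_fun n (p q : {mpoly C[n]}) : (forall v, p.@[v] = q.@[v]) -> p = q.
Proof.
by move=> pq; apply/eqP; rewrite -subr_eq0; apply/eqP/mpoly_fun0 => v; rewrite mevalB pq subrr.
Qed.

(** A polynomial without zeros on a line is constant along it. *)
Lemma meval_line_const n (p : {mpoly C[n]}) (v w : 'I_n -> C) :
  (forall s, p.@[fun i => v i + s * (w i - v i)] != 0) -> p.@[w] = p.@[v].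
Proof.
pose q := mmap polyC (fun i => (v i)%:P + 'X * (w i - v i)%:P) p.
have qE s : q.[s] = p.@[fun i => v i + s * (w i - v i)].
  by rewrite horner_mmap; apply: meval_eq => i; rewrite !hornerE.
move=> q_neq0.
have /eqP/size_poly1P[c _ qc] : size q = 1.
  apply/eqP/negPn/negP => /closed_rootP[s]; rewrite /root qE.
  by rewrite (negPf (q_neq0 s)).
have -> : p.@[w] = q.[1] by rewrite qE; apply: meval_eq => i; rewrite mul1r addrC subrK.
have -> : p.@[v] = q.[0] by rewrite qE; apply: meval_eq => i; rewrite mul0r addr0.
by rewrite qc !hornerC.
Qed.

(** Dividing by the power of the variable that accounts for the root 0 leaves a
    polynomial without roots, that is, a constant. *)
Lemma poly_root_only0 (q : {poly C}) :
  (forall t, t != 0 -> q.[t] != 0) -> exists c k, q = c *: 'X^k.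
Proof.
move=> q_neq0; 
have qn0 : q != 0 by apply: contraNneq (q_neq0 1 (oner_neq0 _)) => ->; rewrite horner0.
have [k [r rN0 qE]] := multiplicity_XsubC q 0; rewrite qn0 /= in rN0.
have /eqP/size_poly1P[c _ rc] : size r = 1.
  apply/eqP/negPn/negP => /closed_rootP[s rs]; have [s0|sn0] := eqVneq s 0.
    by rewrite -s0 rs in rN0.
  by have := q_neq0 s sn0; rewrite qE hornerM (rootP rs) mul0r eqxx.
by exists c, k; rewrite qE rc mul_polyC subr0.
Qed.

Definition mwt n (om : 'I_n -> nat) (m : 'X_{1..n}) := (\sum_(i < n) om i * m i)%N.

(** Along the orbit of a one-parameter torus, a polynomial is a Laurent
    polynomial in the parameter; when it has no zero there it is a monomial, so
    that only one weight occurs at each point outside the zero set. *)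
Lemma mwt_const n (p : {mpoly C[n]}) (om : 'I_n -> nat) :
  (forall v t, t != 0 -> p.@[v] != 0 -> p.@[fun i => t ^+ om i * v i] != 0) ->
  {in msupp p &, forall m1 m2, mwt om m1 = mwt om m2}.
Proof.
move=> p_torus m1 m2 m1p m2p; apply/eqP/negPn/negP => w12.
pose part w := \sum_(m <- msupp p | mwt om m == w) p@_m *: 'X_[m] : {mpoly C[n]}.
have part_neq0 m : m \in msupp p -> part (mwt om m) != 0.
  move=> mp; apply/eqP => /mpolyP/(_ m)/eqP; rewrite mcoeff0 raddf_sum /=.
  rewrite big_mkcond (bigD1_seq m) ?msupp_uniq //= eqxx mcoeffZ mcoeffX eqxx mulr1.
  rewrite big1 ?addr0 ?mcoeff_eq0 ?mp // => m' m'm; case: ifP => // _.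
  by rewrite mcoeffZ mcoeffX (negPf m'm) mulr0.
have pn0 : p != 0 by apply: contraTneq m1p => ->; rewrite msupp0.
have [v] : exists v, (p * part (mwt om m1) * part (mwt om m2)).@[v] != 0.
  by apply: mpoly_neq0_point; rewrite !mulf_neq0 ?part_neq0.
rewrite !mevalM !mulf_eq0 !negb_or -andbA => /and3P[pv p1v p2v].
pose q := mmap polyC (fun i => 'X^(om i) * (v i)%:P) p.
have [t tn0|c [k qk]] := @poly_root_only0 q.
  rewrite horner_mmap (_ : p.@[_] = p.@[fun i => t ^+ om i * v i]) ?p_torus //.
  by apply: meval_eq => i; rewrite !hornerE.
have q_coef w : q`_w = (part w).@[v].
  rewrite /q /mmap coef_sum raddf_sum /= [RHS]big_mkcond; apply: eq_bigr => m _.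
  rewrite /mmap1 (eq_bigr (fun i => 'X^(om i * m i) * (v i ^+ m i)%:P)); last first.
    by move=> i _; rewrite exprMn -exprM polyC_exp.
  rewrite big_split /= -expr_sum -rmorph_prod /= coefCM coefMC coefXn mevalZ mevalX.
  rewrite -/(mwt om m) eq_sym; case: (mwt om m == w); first by rewrite mul1r.
  by rewrite mul0r mulr0.
have nz w : (part w).@[v] != 0 -> w = k.
  by rewrite -q_coef qk coefZ coefXn; have [//|_] := eqVneq w k; rewrite mulr0 eqxx.
by case/eqP: w12; rewrite (nz _ p1v) (nz _ p2v).
Qed.

Lemma meval_mwt n (p : {mpoly C[n]}) (om : 'I_n -> nat) w t (v : 'I_n -> C) :
  (forall m, m \in msupp p -> mwt om m = w) ->
  p.@[fun i => t ^+ om i * v i] = t ^+ w * p.@[v].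
Proof.
move=> pw; rewrite !mevalE big_distrr /= big_seq [RHS]big_seq; apply: eq_bigr => m mp.
rewrite mulrCA -(pw m mp) /mwt expr_sum -big_split /=; congr (_ * _).
by apply: eq_bigr => i _; rewrite exprMn -exprM.
Qed.

Lemma mwt_uniform n (p : {mpoly C[n]}) (om : 'I_n -> nat) :
  (forall v t, t != 0 -> p.@[v] != 0 -> p.@[fun i => t ^+ om i * v i] != 0) ->
  exists w, forall m, m \in msupp p -> mwt om m = w.
Proof.
move=> /mwt_const p_om; case E: (msupp p) => [|m0 r]; first by exists 0%N.
by exists (mwt om m0) => m mp; apply: p_om; rewrite E ?inE ?eqxx.
Qed.

Lemma meval0_mcoeff n (p : {mpoly C[n]}) : p.@[fun=> 0] = p@_0%MM.
Proof.
rewrite [in LHS](mpolyE p) [in RHS](mpolyE p) !raddf_sum /=; apply: eq_bigr => m _.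
rewrite mevalZ mevalX mcoeffZ mcoeffX; congr (_ * _).
have [->|] := eqVneq m 0%MM; first by rewrite big1 // => i _; rewrite mnm0E.
case: (pickP (fun i => m i != 0%N)) => [i mi _|m0 /eqP[]].
  by rewrite (bigD1 i) //= expr0n (negPf mi) mul0r.
by apply/mnmP => i; rewrite mnm0E; apply/eqP/negPn; rewrite m0.
Qed.

End Points.

(** * Polynomial roots from truncated power series *)

Section Filtration.
Variables (C : numClosedFieldType) (n : nat).
Implicit Types (x y z q : {mpoly C[n]}) (S : pred 'I_n) (K D : nat).

(** Membership in the K-th power of the ideal generated by the variables; as these
    ideals are used as congruences, power series are replaced with their truncations. *)
Definition ordge K x := forall m : 'X_{1..n}, (mdeg m < K)%N -> x@_m = 0.

(** The degree in the variables of S; with D = 0, x does not involve them. *)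
Definition vdeg_le S D x :=
  forall m : 'X_{1..n}, m \in msupp x -> (\sum_(i | S i) m i <= D)%N.

Lemma ordgeD K x y : ordge K x -> ordge K y -> ordge K (x + y).
Proof. by move=> xK yK m mK; rewrite mcoeffD xK ?yK ?addr0. Qed.

Lemma ordgeN K x : ordge K x -> ordge K (- x).
Proof. by move=> xK m mK; rewrite mcoeffN xK ?oppr0. Qed.

Lemma ordgeB K x y : ordge K x -> ordge K y -> ordge K (x - y).
Proof. by move=> xK yK; apply: ordgeD xK (ordgeN yK). Qed.

Lemma ordge0 x : ordge 0 x. Proof. by []. Qed.

Lemma ordgeW K L x : (L <= K)%N -> ordge K x -> ordge L x.
Proof. by move=> LK xK m mL; apply: xK; apply: leq_trans LK. Qed.

Lemma ordgeM K L x y : ordge K x -> ordge L y -> ordge (K + L) (x * y).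
Proof.
move=> xK yL m mKL; rewrite mcoeffM big1 // => -[k1 k2] /= /eqP mE.
have : (mdeg k1 + mdeg k2 < K + L)%N by rewrite -mdegD -mE.
have [k1K _|k1K k2L] := ltnP (mdeg k1) K; first by rewrite xK ?mul0r.
rewrite (yL k2) ?mulr0 // -(ltn_add2l K); apply: leq_ltn_trans k2L.
by rewrite leq_add2r.
Qed.

Lemma ordgeMl K x y : ordge K y -> ordge K (x * y).
Proof. by rewrite -[K in ordge K (_ * _)]add0n; apply: ordgeM. Qed.

Lemma ordgeMr K x y : ordge K x -> ordge K (x * y).
Proof. by rewrite mulrC; apply: ordgeMl. Qed.

Lemma ordge1P x : ordge 1 x <-> x@_0%MM = 0.
Proof.
split=> [/(_ 0%MM)|x0 m]; first by rewrite mdeg0; apply.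
by rewrite ltnS leqn0 mdeg_eq0 => /eqP ->.
Qed.

Lemma vdeg_leD S D x y : vdeg_le S D x -> vdeg_le S D y -> vdeg_le S D (x + y).
Proof.
move=> xD yD m /msuppD_le; rewrite mem_cat => /orP[]; [exact: xD|exact: yD].
Qed.

Lemma vdeg_leN S D x : vdeg_le S D x -> vdeg_le S D (- x).
Proof. by move=> xD m; rewrite (perm_mem (msuppN x)); apply: xD. Qed.

Lemma vdeg_leZ S D c x : vdeg_le S D x -> vdeg_le S D (c *: x).
Proof. by move=> xD m /msuppZ_le; apply: xD. Qed.

Lemma vdeg_leM S D D' x y :
  vdeg_le S D x -> vdeg_le S D' y -> vdeg_le S (D + D') (x * y).
Proof.
move=> xD yD m /msuppM_le/allpairsP[[m1 m2] /= [/xD m1D /yD m2D ->]].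
rewrite (eq_bigr (fun i => m1 i + m2 i)%N); last by move=> i _; rewrite mnmDE.
by rewrite big_split leq_add.
Qed.

Lemma vdeg_le1 S D : vdeg_le S D 1.
Proof. by move=> m; rewrite msupp1 inE => /eqP ->; rewrite big1 // => i _; rewrite mnm0E. Qed.

Lemma vdeg_leX S D x k : vdeg_le S D x -> vdeg_le S (k * D) (x ^+ k).
Proof.
move=> xD; elim: k => [|k IH]; first by rewrite expr0; apply: vdeg_le1.
by rewrite exprS mulSn; apply: vdeg_leM.
Qed.

Lemma vdeg_le_msize S x : vdeg_le S (msize x) x.
Proof.
move=> m /msize_mdeg_lt/ltnW; apply: leq_trans.
by rewrite mdegE [leqRHS](bigID S) leq_addr.
Qed.

(** Scaling the variables of S does not move the zeros of x, so all monomials of x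
    have the same degree in them; as 1 is one of the monomials, this degree is 0. *)
Lemma vdeg_le0_fun S x : x@_0%MM != 0 ->
  (forall v w : 'I_n -> C, (forall i, ~~ S i -> v i = w i) -> x.@[v] = x.@[w]) ->
  vdeg_le S 0 x.
Proof.
move=> x0 x_dep; have [|w xw] := @mwt_uniform _ _ x (fun i => S i : nat).
  move=> v t _; rewrite (x_dep _ v) // => i /negPf ->; by rewrite mul1r.
have w0 : w = 0%N.
  rewrite -(xw 0%MM) ?mcoeff_msupp // /mwt big1 // => i _.
  by rewrite mnm0E muln0.
move=> m /xw; rewrite w0 /mwt => m0; rewrite big_mkcond /= -[X in (_ <= X)%N]m0.
by apply: leq_sum => i _; case: (S i); rewrite ?mul1n.
Qed.

Lemma expr1B_quadratic (R : comNzRingType) (y : R) d :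
  exists r, (1 - y) ^+ d = 1 - y *+ d + y ^+ 2 * r.
Proof.
elim: d => [|d [r E]]; first by exists 0; rewrite expr0 mulr0n subr0 mulr0 addr0.
exists (r - y * r + d%:R); rewrite exprS E -[y *+ d]mulr_natr -[y *+ d.+1]mulr_natr -natr1.
by move: (d%:R) => k; ring.
Qed.

(** Newton iteration for z^(-d) = q, which only divides by the integer d and so
    never introduces a variable that q does not involve. *)
Lemma truncated_inverse_root S d q K : (0 < d)%N -> q@_0%MM = 1 -> vdeg_le S 0 q ->
  exists z, [/\ z@_0%MM = 1, vdeg_le S 0 z & ordge K (z ^+ d * q - 1)].
Proof.
move=> d_gt0 q0 qS; have dn0 : d%:R != 0 :> C by rewrite pnatr_eq0 -lt0n.
elim: K => [|[|K] [z [z0 zS zK]]].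
- by exists 1; split; [rewrite mcoeff1 eqxx|exact: vdeg_le1|exact: ordge0].
- exists 1; split; [by rewrite mcoeff1 eqxx|exact: vdeg_le1|].
  by apply/ordge1P; rewrite expr1n mul1r mcoeffB q0 mcoeff1 eqxx subrr.
set e := z ^+ d * q - 1 in zK; pose y := d%:R^-1 *: e.
have yK : ordge K.+1 y by rewrite /y -mul_mpolyC; apply: ordgeMl.
have yd : y *+ d = e by rewrite /y -scaler_nat scalerA divff // scale1r.
have eS : vdeg_le S 0 e.
  apply: vdeg_leD; last exact/vdeg_leN/vdeg_le1.
  by rewrite -[0%N]addn0; apply: vdeg_leM => //; rewrite -[0%N](muln0 d); apply: vdeg_leX.
exists (z * (1 - y)); split.
- have /ordge1P y0 : ordge 1 y by apply: ordgeW yK.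
  by rewrite rmorphM /= mcoeffB z0 mcoeff1 eqxx y0 subr0 mulr1.
- rewrite -[0%N]addn0; apply: vdeg_leM => //; apply: vdeg_leD; first exact: vdeg_le1.
  by apply/vdeg_leN/vdeg_leZ.
(* If z^d q = 1 + e, then (z (1 - e / d))^d q = (1 + e) (1 - e + O(e^2)) = 1 + O(e^2). *)
have [r E] := expr1B_quadratic y d.
have -> : (z * (1 - y)) ^+ d * q - 1 = y * (y * ((1 + e) * r)) - e * e.
  rewrite exprMn mulrAC (_ : z ^+ d * q = 1 + e); last by rewrite addrC subrK.
  by rewrite E yd; ring.
have K2 : (K.+2 <= K.+1 + K.+1)%N by rewrite addSn ltnS leq_addl.
by apply: ordgeB; apply: (ordgeW K2); apply: ordgeM => //; apply: ordgeMr.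
Qed.

(** In x^d - y^d = (x - y) (x^(d-1) + .. + y^(d-1)) the second factor has the
    constant term d, so it is invertible modulo each power of the ideal. *)
Lemma root_unique_mod d x y K : (0 < d)%N -> x@_0%MM = 1 -> y@_0%MM = 1 ->
  ordge K (x ^+ d - y ^+ d) -> ordge K (x - y).
Proof.
move=> d_gt0 x0 y0; have dn0 : d%:R != 0 :> C by rewrite pnatr_eq0 -lt0n.
rewrite subrXX; set s := \sum_(i < d) _ => xyK.
pose u := d%:R^-1 *: s.
have u0 : u@_0%MM = 1.
  rewrite mcoeffZ raddf_sum /= (eq_bigr (fun=> 1)).
    by rewrite sumr_const card_ord mulVf.
  by move=> i _; rewrite rmorphM !rmorphXn /= x0 y0 !expr1n mulr1.
have [z [_ _]] := truncated_inverse_root K (ltn0Sn 0) u0 (fun m _ => eq_leq (big_pred0_eq _ _ _ _)).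
rewrite expr1 => zK.
have -> : x - y = ((x - y) * s) * (d%:R^-1 *: z) - (x - y) * (z * u - 1).
  by rewrite /u -!mul_mpolyC; ring.
by apply: ordgeB; [apply: ordgeMr|apply: ordgeMl].
Qed.

(** Modulo high powers of the maximal ideal, q has a unique d-th root with
    constant term 1.  The hypotheses exhibit it as the polynomial g j times a
    power series free of the variables in S j, so that its degree in those
    variables is bounded.  If this happens for sets S j that cover all
    variables, the root is a polynomial. *)
Lemma polynomial_root (J : finType) (j0 : J) (S : J -> pred 'I_n) d q
    (g w : J -> {mpoly C[n]}) :
  (0 < d)%N -> (forall i, exists j, S j i) ->
  (forall j, (g j)@_0%MM = 1) -> (forall j, (w j)@_0%MM = 1) ->
  (forall j, vdeg_le (S j) 0 (w j)) -> (forall j, g j ^+ d = q * w j) ->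
  exists2 f, f ^+ d = q & f@_0%MM = 1.
Proof.
move=> d_gt0 S_cover g0 w0 wS gq.
(* D bounds the degree of the root to be found; modulo degree K, which exceeds the
   degrees of both q and f^d, a congruence between the two is an equality. *)
pose D := (\sum_j msize (g j))%N; pose K := (maxn (msize q) (d * D)).+1.
have zP j := truncated_inverse_root K d_gt0 (w0 j) (wS j).
pose z j := projT1 (cid (zP j)); pose h j := g j * z j.
have h0 j : (h j)@_0%MM = 1.
  by rewrite rmorphM /= g0 /z; case: cid => /= ? [-> _ _]; rewrite mulr1.
have hq j : ordge K (h j ^+ d - q).
  rewrite exprMn gq /z; case: cid => /= y [_ _ yK].
  rewrite (_ : _ - q = q * (y ^+ d * w j - 1)); first exact: ordgeMl.
  by ring.
have hS j : vdeg_le (S j) (msize (g j)) (h j).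
  rewrite -[msize _]addn0; apply: vdeg_leM; first exact: vdeg_le_msize.
  by rewrite /z; case: cid => /= ? [].
have h_eq j k : ordge K (h j - h k).
  apply: (root_unique_mod d_gt0) => //.
  by rewrite -[_ - _](subrKA q) -[q - _]opprB; apply: ordgeB.
(* All h j agree below degree K, so a monomial of f satisfies the degree bound of
   each h j in the variables of S j; these bounds add up to D. *)
pose f := \sum_(m <- msupp (h j0) | (mdeg m < K)%N) (h j0)@_m *: 'X_[m].
have f_coef m : f@_m = if (mdeg m < K)%N then (h j0)@_m else 0.
  rewrite raddf_sum big_mkcond /=; have [mh|mh] := boolP (m \in msupp (h j0)).
    rewrite (bigD1_seq m) ?msupp_uniq //= mcoeffZ mcoeffX eqxx mulr1.
    rewrite big1 ?addr0 // => m' m'm; case: ifP => // _.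
    by rewrite mcoeffZ mcoeffX (negPf m'm) mulr0.
  rewrite (memN_msupp_eq0 mh) if_same big_seq_cond big1 // => m' /andP[m'h _].
  case: ifP => // _; rewrite mcoeffZ mcoeffX.
  by case: eqP m'h mh => [->->//|]; rewrite mulr0.
have fK : ordge K (f - h j0).
  by move=> m mK; rewrite mcoeffB f_coef mK subrr.
have fD : vdeg_le predT D f.
  move=> m; rewrite mcoeff_msupp f_coef; case: ifP => [mK hm|]; last by rewrite eqxx.
  have mh j : m \in msupp (h j).
    by rewrite mcoeff_msupp -(subrK (h j0) (h j)) mcoeffD h_eq // add0r.
  apply: (@leq_trans (\sum_j \sum_(i | S j i) m i)%N); last first.
    by apply: leq_sum => j _; apply: hS (mh j).
  rewrite (exchange_big_dep predT) //=; apply: leq_sum => i _.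
  by have [j Sji] := S_cover i; rewrite (bigD1 j) //= leq_addr.
have fq : ordge K (f ^+ d - q).
  rewrite -[_ - q](subrKA (h j0 ^+ d)); apply: ordgeD => //.
  by rewrite subrXX; apply: ordgeMr.
exists f; last by rewrite f_coef mdeg0 ltn0Sn h0.
apply/eqP; rewrite -subr_eq0; apply/eqP/mpolyP => m; rewrite mcoeff0.
have [mK|Km] := ltnP (mdeg m) K; first exact: fq.
apply: memN_msupp_eq0; apply: contraL Km => /msuppB_le; rewrite mem_cat -ltnNge /K ltnS => /orP[].
  move=> /(vdeg_leX (k := d) fD); rewrite -mdegE => mD.
  by apply: leq_trans mD (leq_maxr _ _).
by move=> /msize_mdeg_lt/ltnW mq; apply: leq_trans mq (leq_maxl _ _).
Qed.
End Filtration.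

(** * Multiplicativity in the form with varying coefficients *)

Lemma rmorph_mmap n (R S T : comNzRingType) (phi : {rmorphism S -> T})
    (f : R -> S) (h : 'I_n -> S) (p : {mpoly R[n]}) :
  phi (mmap f h p) = mmap (phi \o f) (phi \o h) p.
Proof.
rewrite /mmap rmorph_sum; apply: eq_bigr => m _.
by rewrite rmorphM rmorph_prod; congr (_ * _); apply: eq_bigr => i _; rewrite rmorphXn.
Qed.

Section Separation.
Variable C : numClosedFieldType.

(** The factorisation normalised at 0 rather than at infinity: its factors are then
    determined by the roots alone, even when the degree is only bounded. *)
Lemma poly_normal_at0 (q : {poly C}) : q.[0] != 0 ->
  exists rs, [/\ all (root q) rs, (size rs <= size q)%N &
    q = q.[0] *: \prod_(r <- rs) (1 - r^-1 *: 'X)].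
Proof.
move=> q0; have [rs qE] := closed_field_poly_normal q.
have qn0 : q != 0 by apply: contraNneq q0 => ->; rewrite horner0.
have lc0 : lead_coef q != 0 by rewrite lead_coef_eq0.
have rs_root : all (root q) rs.
  by rewrite qE; apply/allP => r r_rs; rewrite rootZ // root_prod_XsubC.
have qE' : q = (lead_coef q * \prod_(r <- rs) (- r)) *: \prod_(r <- rs) (1 - r^-1 *: 'X).
  rewrite {1}qE -scalerA; congr (_ *: _); rewrite -mul_polyC rmorph_prod -big_split /=.
  rewrite big_seq [RHS]big_seq; apply: eq_bigr => r r_rs.
  have rn0 : r != 0.
    by apply: contraNneq q0 => r0; move/allP/(_ r r_rs): rs_root; rewrite r0.
  by rewrite mul_polyC scalerBr scalerA mulNr divff // scaleN1r opprK alg_polyC polyCN addrC.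
exists rs; split=> //; first by rewrite qE size_scale // size_prod_XsubC.
suff <- : lead_coef q * \prod_(r <- rs) (- r) = q.[0] by [].
rewrite [in RHS]qE' hornerZ horner_prod [X in _ = _ * X]big1 ?mulr1 // => r _.
by rewrite !hornerE subr0.
Qed.

(** A two-variable polynomial whose zeros in t stay in a fixed finite set
    separates: normalised at t = 0, it can only take finitely many values as a
    polynomial in t, hence takes one of them for all s. *)
Lemma separated_variables (P : {poly {poly C}}) (Y : seq C) :
  P.[0] != 0 ->
  (forall s t, P.[0].[s] != 0 -> P.[t%:P].[s] = 0 -> t \in Y) ->
  exists M : {poly C}, forall s t, P.[t%:P].[s] = P.[0].[s] * M.[t].
Proof.
move=> l0 PY; set l := P.[0] in l0 PY *.
(* Since 0^-1 = 0, the element 0 stands for a trivial factor 1; adding it to Y makes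
   it possible to list factorisations of any length at most N as N-tuples. *)
pose T := seq_sub (0 :: Y); pose y0 : T := SeqSub (mem_head 0 Y).
pose N := size P.
pose M (f : {ffun 'I_N -> T}) : {poly C} := \prod_i (1 - (val (f i))^-1 *: 'X).
have option_ex s : l.[s] != 0 -> exists f, forall t, P.[t%:P].[s] = l.[s] * (M f).[t].
  move=> ls; pose q := map_poly (horner_eval s) P.
  have qt t : q.[t] = P.[t%:P].[s].
    by rewrite -[t in q.[t]](hornerC t s) -/(horner_eval s t%:P) horner_map.
  have [|rs [rs_root rs_size qE]] := @poly_normal_at0 q; first by rewrite qt.
  have rsN : (size rs <= N)%N by apply: leq_trans rs_size (size_poly _ _).
  exists [ffun i : 'I_N => insubd y0 (nth 0 rs i)] => t.
  rewrite -qt {1}qE hornerZ qt; congr (_ * _); congr (_.[t]).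
  rewrite (big_nth 0) big_mkord (big_ord_widen N (fun i => 1 - (nth 0 rs i)^-1 *: 'X)) //.
  rewrite big_mkcond; apply: eq_bigr => i _; rewrite ffunE val_insubd inE.
  case: ltnP => [irs|?]; last by rewrite nth_default // eqxx /= invr0 scale0r subr0.
  rewrite (PY s) ?orbT // -qt; apply/rootP.
  by move/allP: rs_root; apply; apply: mem_nth.
(* One factor of Q vanishes at each s with l.[s] != 0, hence l Q = 0 and, in an
   integral domain, one factor vanishes identically. *)
pose Q := \prod_(f : {ffun 'I_N -> T}) (P - l%:P * map_poly polyC (M f)).
have /eqP : l%:P * Q = 0.
  apply: poly2_fun0 => s t; rewrite hornerM hornerC hornerM.
  have [->|ls] := eqVneq l.[s] 0; first by rewrite mul0r.
  have [f fP] := option_ex s ls; rewrite /Q (bigD1 f) //= !hornerM.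
  rewrite hornerD hornerN hornerM hornerC horner_map hornerD hornerN hornerM (fP t).
  by rewrite [(_ (M f).[t]).[s]]hornerC subrr mul0r mulr0.
rewrite mulf_eq0 polyC_eq0 (negPf l0) /= => /prodf_eq0[f _]; rewrite subr_eq0 => /eqP Pf.
exists (M f) => s t; rewrite [in LHS]Pf hornerM hornerC horner_map hornerM.
by rewrite hornerC.
Qed.

End Separation.

Section Multiplicativity.
Variables (C : numClosedFieldType) (N : nat) (p : {mpoly C[N]}).
Variables (coef_index : 'I_N -> option nat) (b : 'I_N -> C).

Definition coef_subst (G : {poly C}) : 'I_N -> C :=
  fun k => if coef_index k is Some i then G`_i else b k.

(** In both arguments the zeros of p on products of linear polynomials only
    depend on the set Z; the separation of variables then makes p
    multiplicative on powers of the variable. *)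
Lemma multiplicative_on_powers (d k : nat) (Z : C -> Prop) :
  (forall G : {poly C}, (size G <= d.+1)%N ->
     (p.@[coef_subst G] = 0 <-> exists2 y, Z y & root G y)) ->
  (k < d)%N -> p.@[coef_subst 1] != 0 ->
  p.@[coef_subst 'X^(k.+1)] * p.@[coef_subst 1] =
  p.@[coef_subst 'X^k] * p.@[coef_subst 'X].
Proof.
move=> pZ kd h1.
(* The pencil (1 - t) + t X joins 1, at t = 0, to X, at t = 1. *)
pose lin (R : comNzRingType) (t : R) : {poly R} := (1 - t)%:P + t *: 'X.
have size_lin t : (size (lin C t) <= 2)%N.
  rewrite (leq_trans (size_polyD _ _)) // geq_max (leq_trans (size_polyC_leq1 _)) //.
  by rewrite (leq_trans (size_scale_leq _ _)) // size_polyX.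
have size_linX s t : (size (lin C s ^+ k * lin C t)%R <= d.+1)%N.
  have H : (size (lin C s ^+ k)%R <= k.+1)%N.
    elim: k {kd} => [|j IH]; first by rewrite expr0 size_poly1.
    rewrite exprS (leq_trans (size_polyMleq _ _)) // -subn1 leq_subLR add1n.
    by rewrite (leq_trans (leq_add (size_lin s) IH)).
  rewrite (leq_trans (size_polyMleq _ _)) // -subn1 leq_subLR add1n.
  by rewrite (leq_trans (leq_add H (size_lin t))) // addn2 !ltnS.
have size_linX0 s : (size (lin C s ^+ k)%R <= d.+1)%N.
  have := size_linX s 0; suff -> : lin C s ^+ k * lin C 0 = lin C s ^+ k by [].
  by rewrite /lin subr0 scale0r addr0 mulr1.
pose RR : comNzRingType := {poly {poly C}}.
pose GG : {poly RR} := lin RR ('X%:P : RR) ^+ k * lin RR ('X : RR).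
pose P : RR := mmap ((polyC : {rmorphism {poly C} -> RR}) \o (polyC : {rmorphism C -> {poly C}}))
  (fun j => if coef_index j is Some i then GG`_i else (b j)%:P%:P) p.
have P_eval s t : P.[t%:P].[s] = p.@[coef_subst (lin C s ^+ k * lin C t)].
  pose phi : {rmorphism RR -> C} := horner_eval s \o horner_eval t%:P.
  rewrite -[LHS]/(phi P) /P rmorph_mmap /meval /mmap.
  apply: eq_bigr => m _; congr (_ * _); first by rewrite /= /phi /= /horner_eval !hornerC.
  apply: eq_bigr => j _; congr (_ ^+ _); rewrite /coef_subst /=.
  case: (coef_index j) => [i|]; last by rewrite /horner_eval !hornerC.
  rewrite -[LHS]/(phi (GG`_i)) -coef_map; congr (_`_i).
  have phi_lin r : map_poly phi (lin RR r) = lin C (phi r).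
    rewrite /lin rmorphD /= map_polyC map_polyZ map_polyX; congr (_%:P + _).
    by rewrite -[LHS]/(phi (1 - r)) rmorphB rmorph1.
  rewrite /GG rmorphM rmorphXn /= !phi_lin; congr (lin C _ ^+ k * lin C _).
    by rewrite /phi /= /horner_eval hornerC hornerX.
  by rewrite /phi /= /horner_eval hornerX hornerC.
have lin0 : lin C 0 = 1 by rewrite /lin subr0 scale0r addr0.
have lin1 : lin C 1 = 'X by rewrite /lin subrr scale1r add0r.
have P0 s : P.[0].[s] = p.@[coef_subst (lin C s ^+ k)].
  by have := P_eval s 0; rewrite polyC0 lin0 mulr1.
pose beta : {poly C} := mmap polyC (fun j => if coef_index j is Some i then (lin {poly C} 'X)`_i
  else (b j)%:P) p.
have beta_eval t : beta.[t] = p.@[coef_subst (lin C t)].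
  rewrite -[LHS]/(horner_eval t beta) rmorph_mmap /meval /mmap.
  apply: eq_bigr => m _; congr (_ * _); first by rewrite /= /horner_eval hornerC.
  apply: eq_bigr => j _; congr (_ ^+ _); rewrite /coef_subst /=.
  case: (coef_index j) => [i|]; last by rewrite /horner_eval hornerC.
  rewrite -coef_map; congr (_`_i).
  rewrite /lin rmorphD /= map_polyC map_polyZ map_polyX; congr (_%:P + _ *: _).
    by rewrite /= /horner_eval hornerD hornerN hornerC hornerX.
  by rewrite /= /horner_eval hornerX.
have beta0 : beta != 0.
  by apply: contraNneq h1 => zero_bfilling; rewrite -lin0 -beta_eval zero_bfilling horner0.
have [Y betaY] : {Y : seq C | forall t, root beta t -> t \in Y}.
  have [rs E] := closed_field_poly_normal beta; exists rs => t.
  by rewrite E rootZ ?lead_coef_eq0 // root_prod_XsubC.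
have [||M PM] := @separated_variables C P Y.
- apply: contraNneq h1 => P00; rewrite -(expr1n _ k) -lin0 -P0.
  by rewrite P00 horner0.
- move=> s t; rewrite P0 P_eval => ls0 /(pZ _ (size_linX s t))[y Zy].
  rewrite rootM => /orP[yA|yB].
    by case/eqP: ls0; apply/(pZ _ (size_linX0 s)); exists y.
  apply/betaY/rootP; rewrite beta_eval; apply/pZ; last by exists y.
  by rewrite (leq_trans (size_lin t)) // ltnS (leq_ltn_trans _ kd).
have := PM 0 0; have := PM 0 1; have := PM 1 1.
rewrite !P0 !P_eval lin0 lin1 expr1n !mul1r -exprSr => -> -> _.
by rewrite mulrAC mulrA.
Qed.

End Multiplicativity.

(** * Cells *)

Section Cells.
Variables (n : nat) (d : 'I_n -> nat).
Implicit Types c : cell d.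

Lemma mdeg_expo c : mdeg (expo c) = d (row_of c).
Proof. exact: (eqP (valP (tagged c))). Qed.

Lemma cell_inj c c' : row_of c = row_of c' -> expo c = expo c' -> c = c'.
Proof.
case: c c' => i m [i' m'] /= E; rewrite /row_of /= in E.
by case: i' / E m' => m' mm'; congr Tagged; do 2!apply: val_inj.
Qed.

Lemma mkcell_bound (i : 'I_n) (m : 'X_{1..n}) : mdeg m = d i -> (mdeg m < (d i).+1)%N.
Proof. by move=> ->. Qed.

Definition mkcell (i : 'I_n) (m : 'X_{1..n}) (mi : mdeg m = d i) : cell d :=
  Tagged (fun i : 'I_n => {m : 'X_{1..n < (d i).+1} | mdeg m == d i})
    (exist (fun m : 'X_{1..n < (d i).+1} => mdeg m == d i)
       (BMultinom (mkcell_bound mi)) (introT eqP mi)).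

Lemma row_mkcell i m (mi : mdeg m = d i) : row_of (mkcell mi) = i.
Proof. by []. Qed.

Lemma expo_mkcell i m (mi : mdeg m = d i) : expo (mkcell mi) = m.
Proof. by []. Qed.

Lemma evecE (i : 'I_n) : evec n i = U_(i)%MM.
Proof. by apply/mnmP => j; rewrite mnmE mnm1E eq_sym. Qed.

Lemma mdeg_pure (i : 'I_n) k : mdeg (U_(i) *+ k)%MM = k.
Proof. by rewrite mdegMn mdeg1 mul1n. Qed.

Definition pure_cell (i : 'I_n) : cell d := mkcell (mdeg_pure i (d i)).

Definition is_pure c : bool := expo c == (U_(row_of c) *+ d (row_of c))%MM.

Lemma is_pureP c : is_pure c = (c == pure_cell (row_of c)).
Proof.
apply/eqP/eqP => [E|->]; last by rewrite row_mkcell expo_mkcell.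
by apply: cell_inj.
Qed.

Lemma expo_single c (i : 'I_n) : expo c i = d (row_of c) ->
  expo c = (U_(i) *+ d (row_of c))%MM.
Proof.
move=> ci; apply/mnmP => k; rewrite mulmnE mnm1E.
have := mdeg_expo c; rewrite mdegE (bigD1 i) //= ci => /eqP.
rewrite -[X in _ == X]addn0 eqn_add2l sum_nat_eq0 => /forallP/(_ k).
have [->|_] := eqVneq k i; first by rewrite ci mul1n.
by rewrite mul0n => /eqP.
Qed.

End Cells.

(** * Resultants of forms in the last variables *)

Section Level.
Variables (C : numClosedFieldType) (n : nat) (d : 'I_n -> nat).
Local Notation N := #|{: cell d}|.
Implicit Types (c : cell d) (a b : cell d -> C) (x : 'I_n -> C) (l : nat).

(** The variables are indexed by the ranks of the cells. *)
Definition point a : 'I_N -> C := fun k => a (enum_val k).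

Definition mono c x : C := \prod_(j < n) x j ^+ expo c j.

Definition formv a (i : 'I_n) x : C := \sum_(c | row_of c == i) a c * mono c x.

(** The restriction to the subspace where the first l coordinates vanish is a condition
    on the zero, not on the forms: all levels then share the same variables. *)
Definition czero_at l a x := [/\ exists j, x j != 0, forall j : 'I_n, (j < l)%N -> x j = 0
  & forall i : 'I_n, (l <= i)%N -> formv a i x = 0].

Definition czero l a := exists x, czero_at l a x.

Definition pure c : C := (is_pure c)%:R.

(** The analogue of A1, A2, A3 for the forms of the rows l, l + 1, .. restricted to
    the subspace where the first l variables vanish.  The absence of the other
    coefficients and the homogeneity for the weights follow. *)
Definition is_res l (p : {mpoly C[N]}) :=
  [/\ forall a, p.@[point a] = 0 <-> czero l a,
      forall (i : 'I_n) m, (l <= i)%N -> m \in msupp p ->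
        (\sum_(c | row_of c == i) m (enum_rank c) = delta d l i)%N
    & p.@[point pure] = 1].

Lemma Dset_row l c : c \in Dset d l -> (l <= row_of c)%N.
Proof. by rewrite inE => /andP[]. Qed.

Lemma Dset_expo l c (j : 'I_n) : c \in Dset d l -> (j < l)%N -> expo c j = 0%N.
Proof. by rewrite inE => /andP[_ /forallP/(_ j)/implyP H] /H /eqP. Qed.

Lemma DsetP l c : reflect ((l <= row_of c)%N /\ forall j : 'I_n, (j < l)%N -> expo c j = 0%N)
  (c \in Dset d l).
Proof.
apply: (iffP idP) => [cD|[cl ce]]; first by split; [exact: Dset_row|move=> j; apply: Dset_expo].
by rewrite inE cl; apply/forallP => j; apply/implyP => jl; rewrite ce.
Qed.

Lemma mono0 c x (j : 'I_n) : x j = 0 -> expo c j != 0%N -> mono c x = 0.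
Proof. by move=> xj cj; rewrite /mono (bigD1 j) //= xj expr0n (negPf cj) mul0r. Qed.

Lemma mono_Dset l c x : (forall j : 'I_n, (j < l)%N -> x j = 0) -> (l <= row_of c)%N ->
  c \notin Dset d l -> mono c x = 0.
Proof.
move=> x0 cl; rewrite inE cl negb_forall => /existsP[j]; rewrite negb_imply => /andP[jl].
by apply: mono0; apply: x0.
Qed.

Lemma mono_scale c x (t : C) (om : 'I_n -> nat) :
  mono c (fun j => t ^+ om j * x j) = t ^+ (\sum_j om j * expo c j)%N * mono c x.
Proof.
rewrite /mono expr_sum -big_split; apply: eq_bigr => j _.
by rewrite exprMn exprM.
Qed.

Lemma mono_pure (i : 'I_n) x : mono (pure_cell d i) x = x i ^+ d i.
Proof.
rewrite /mono expo_mkcell (bigD1 i) //= big1 => [|j ji].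
  by rewrite mulmnE mnm1E eqxx mul1n mulr1.
by rewrite mulmnE mnm1E eq_sym (negPf ji) expr0.
Qed.

Lemma pure_pure (i : 'I_n) : pure (pure_cell d i) = 1.
Proof. by rewrite /pure is_pureP eqxx. Qed.

Lemma formv_single a (i : 'I_n) x c0 : row_of c0 = i ->
  (forall c, row_of c = i -> c != c0 -> a c * mono c x = 0) ->
  formv a i x = a c0 * mono c0 x.
Proof.
move=> c0i H; rewrite /formv (bigD1 c0) ?c0i //= big1 ?addr0 //.
by move=> c /andP[/eqP ci cc0]; apply: H.
Qed.

Lemma formv_eq a b (i : 'I_n) x :
  (forall c, row_of c = i -> mono c x != 0 -> a c = b c) -> formv a i x = formv b i x.
Proof.
move=> ab; apply: eq_bigr => c /eqP ci.
by have [->|xc] := eqVneq (mono c x) 0; rewrite ?mulr0 // ab.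
Qed.

(** A pure row forces its variable to vanish at a common zero. *)
Lemma formv_pure_row a (i : 'I_n) x : (forall c, row_of c = i -> a c = pure c) ->
  formv a i x = x i ^+ d i.
Proof.
move=> a_pure; rewrite (@formv_single _ _ _ (pure_cell d i)) // => [|c ci cc0].
  by rewrite a_pure // pure_pure mul1r mono_pure.
by rewrite a_pure // /pure is_pureP ci (negPf cc0) mul0r.
Qed.

Lemma czero_ext l a b : (forall c, c \in Dset d l -> a c = b c) -> czero l a -> czero l b.
Proof.
move=> ab [x [xn0 x0 ax]]; exists x; split=> // i li; rewrite -(ax i li).
apply: formv_eq => c ci xc; apply/esym/ab; apply: contraR xc => cD; apply/eqP.
by apply: (mono_Dset x0) cD; rewrite ci.
Qed.

(** Values of a resultant only depend on data that determine the existence of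
    common zeros, since a polynomial without zeros on a line is constant. *)
Lemma res_dep l p (S : pred (cell d)) a b : is_res l p ->
  (forall c, S c -> a c = b c) ->
  (forall u, (forall c, S c -> u c = a c) -> (czero l u <-> czero l a)) ->
  p.@[point b] = p.@[point a].
Proof.
move=> [pz _ _] ab Sz.
have [pa|pa] := eqVneq (p.@[point a]) 0.
  by rewrite pa; apply/pz/Sz; [move=> c /ab ->|apply/pz].
apply: meval_line_const => s.
have -> : p.@[fun i => point a i + s * (point b i - point a i)] =
          p.@[point (fun c => a c + s * (b c - a c))] by apply: meval_eq.
apply: contra pa => /eqP/pz/Sz H; apply/eqP/pz/H => c Sc.
by rewrite ab // subrr mulr0 addr0.
Qed.

Lemma mwt_cells (om : cell d -> nat) (m : 'X_{1..N}) :
  mwt (fun k => om (enum_val k)) m = (\sum_c om c * m (enum_rank c))%N.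
Proof.
rewrite /mwt (reindex (@enum_rank (cell d))) /=.
  by apply: eq_bigr => c _; rewrite enum_rankK.
by exists enum_val => k _; [apply: enum_rankK|apply: enum_valK].
Qed.

Lemma exprn2_inj (w w' : nat) : (2%:R : C) ^+ w = 2%:R ^+ w' -> w = w'.
Proof. by move/eqP; rewrite -!natrX eqr_nat eqn_exp2l // => /eqP. Qed.

(** Since the zero locus is stable under the torus, a resultant is homogeneous
    for each weight; the weight is read off at the pure powers. *)
Lemma zero_weight l (p : {mpoly C[N]}) (om : cell d -> nat) :
  (forall a, p.@[point a] = 0 <-> czero l a) ->
  (forall a t, t != 0 -> czero l (fun c => t ^+ om c * a c) -> czero l a) ->
  exists w, forall m, m \in msupp p -> (\sum_c om c * m (enum_rank c) = w)%N.
Proof.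
move=> pz om_z; have [|w pw] := @mwt_uniform _ _ p (fun k => om (enum_val k)).
  move=> v t t0; apply: contra => /eqP pv; apply/eqP.
  have vE a : (forall k, point a k = v k) -> p.@[point a] = p.@[v] by move/meval_eq.
  rewrite -(vE (fun c => v (enum_rank c))) => [|k]; last by rewrite /point enum_valK.
  apply/pz/(om_z _ t) => //; apply/pz; rewrite -{}pv; apply: meval_eq => k.
  by rewrite /point enum_valK.
by exists w => m mp; rewrite -mwt_cells pw.
Qed.

Lemma meval_weight (p : {mpoly C[N]}) (om : cell d -> nat) w t a :
  (forall m, m \in msupp p -> (\sum_c om c * m (enum_rank c) = w)%N) ->
  p.@[point (fun c => t ^+ om c * a c)] = t ^+ w * p.@[point a].
Proof.
move=> pw; rewrite -(@meval_mwt _ _ _ (fun k => om (enum_val k))) // => m mp.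
by rewrite mwt_cells pw.
Qed.

(** Scaling each form by a nonzero constant keeps its zeros. *)
Lemma czero_scale_rows l (rho : 'I_n -> nat) a t : t != 0 ->
  czero l (fun c => t ^+ rho (row_of c) * a c) -> czero l a.
Proof.
move=> t0 [x [xn0 x0 ax]]; exists x; split=> // i li.
have /eqP := ax i li; rewrite /formv (eq_bigr (fun c => t ^+ rho i * (a c * mono c x))).
  by rewrite -big_distrr mulf_eq0 expf_eq0 (negPf t0) andbF => /eqP.
by move=> c /eqP ->; rewrite mulrA.
Qed.

(** Scaling the coefficients by the exponent of x_j is a change of variable. *)
Lemma czero_scale_vars l (j : 'I_n) a t : t != 0 ->
  czero l (fun c => t ^+ expo c j * a c) -> czero l a.
Proof.
move=> t0 [x [[k xk] x0 ax]]; exists (fun i => t ^+ (i == j) * x i).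
split=> [|i il|i li]; first by exists k; rewrite mulf_neq0 // expf_neq0.
  by rewrite x0 ?mulr0.
rewrite -(ax i li); apply: eq_bigr => c _; rewrite mono_scale (bigD1 j) //= eqxx mul1n.
by rewrite big1 ?addn0 => [|k' /negPf -> //]; rewrite mulrCA mulrA.
Qed.

Lemma row_weight (i : 'I_n) (m : 'X_{1..N}) :
  (\sum_c (row_of c == i) * m (enum_rank c) = \sum_(c | row_of c == i) m (enum_rank c))%N.
Proof.
by rewrite [RHS]big_mkcond; apply: eq_bigr => c _; case: eqP; rewrite ?mul1n ?mul0n.
Qed.

(** At the pure powers, scaling x_j by t amounts to scaling row j by t^(d j), and
    the degree in row j is known. *)
Lemma res_expo l p (j : 'I_n) m : is_res l p -> (l <= j)%N -> m \in msupp p ->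
  (\sum_c expo c j * m (enum_rank c) = d j * delta d l j)%N.
Proof.
move=> [pz p_row p1] lj; have [w pw] := zero_weight pz (@czero_scale_vars l j).
move=> mp; rewrite (pw _ mp); apply: exprn2_inj.
have := meval_weight 2%:R pure pw; rewrite p1 mulr1 => <-.
have p_row' m' : m' \in msupp p -> (\sum_c (row_of c == j) * m' (enum_rank c) = delta d l j)%N.
  by move=> /(p_row _ _ lj); rewrite row_weight.
have := meval_weight (2%:R ^+ d j) pure p_row'; rewrite p1 mulr1 -exprM => <-.
apply: meval_eq => k; rewrite /point /pure; case: (boolP (is_pure _)) => [|_];
  last by rewrite !mulr0.
rewrite is_pureP => /eqP ->; rewrite row_mkcell expo_mkcell mulmnE mnm1E.
by case: eqP => [->|_]; rewrite ?mul1n ?mul0n ?expr0.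
Qed.

(** A weight supported on coefficients that do not affect the zeros must vanish:
    otherwise the resultant would be 0 at the pure powers, scaled by t = 0. *)
Lemma res_supp l p m c : is_res l p -> m \in msupp p -> c \notin Dset d l ->
  m (enum_rank c) = 0%N.
Proof.
move=> [pz p_row p1] mp cD.
have [|w pw] := @zero_weight l p (fun c => c \notin Dset d l : nat) pz.
  move=> a t _; apply: czero_ext => c' c'D; by rewrite c'D mul1r.
suff w0 : w = 0%N.
  have := pw m mp; rewrite w0 => /eqP; rewrite sum_nat_eq0 => /forallP/(_ c).
  by rewrite cD mul1n => /eqP.
case: w pw => // w /(meval_weight 0 pure); rewrite p1 exprS !mul0r.
move=> /pz z0; have : czero l pure.
  by apply: czero_ext z0 => c' c'D; rewrite c'D mul1r.
by move/pz/eqP; rewrite p1 oner_eq0.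
Qed.

End Level.

(** * From one level to the next *)

Section Descent.
Variables (C : numClosedFieldType) (n : nat) (d : 'I_n -> nat).
Hypothesis d_gt0 : forall i, (0 < d i)%N.
Local Notation N := #|{: cell d}|.
Local Notation pure := (@pure C n d).
Implicit Types (c : cell d) (a b : cell d -> C) (x : 'I_n -> C) (G : {poly C}).
Variable L : 'I_n.

Definition pure_row a c : C := if row_of c == L then pure c else a c.

(** The first form x_L^d imposes x_L = 0, which leads to the next level. *)
Lemma czero_pure_row a b : (forall c, c \in Dset d L.+1 -> a c = b c) ->
  (forall c, row_of c = L -> a c = pure c) -> czero L a <-> czero L.+1 b.
Proof.
move=> ab aL; split=> -[x [xn0 x0 ax]].
  have xL : x L = 0.
    by have /eqP := ax L (leqnn _); rewrite formv_pure_row // expf_eq0 => /andP[_ /eqP].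
  have x0' (j : 'I_n) : (j < L.+1)%N -> x j = 0.
    by rewrite ltnS leq_eqVlt => /orP[/eqP/val_inj ->|/x0].
  exists x; split=> // i Li; rewrite -(ax i (ltnW Li)).
  apply: formv_eq => c ci xc; apply/esym/ab; apply: contraR xc => cD; apply/eqP.
  by apply: (mono_Dset x0') cD; rewrite ci.
have x0' (j : 'I_n) : (j < L)%N -> x j = 0 by move=> jL; apply/x0/leqW.
exists x; split=> // i; rewrite leq_eqVlt => /orP[/eqP/val_inj <-|Li].
  by rewrite formv_pure_row // x0 // expr0n eqn0Ngt d_gt0.
rewrite -(ax i Li); apply: formv_eq => c ci xc; apply/ab; apply: contraR xc => cD; apply/eqP.
by apply: (mono_Dset x0) cD; rewrite ci.
Qed.

Lemma res_pure_row p a b : is_res L p -> (forall c, c \in Dset d L.+1 -> a c = b c) ->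
  (forall c, row_of c = L -> a c = pure c) -> (forall c, row_of c = L -> b c = pure c) ->
  p.@[point a] = p.@[point b].
Proof.
move=> pR ab aL bL.
apply: (@res_dep _ _ _ L p (fun c => (row_of c == L) || (c \in Dset d L.+1))) => //.
  by move=> c /orP[/eqP cL|cD]; [rewrite aL ?bL|rewrite ab].
move=> u ub; rewrite (@czero_pure_row u b) ?(@czero_pure_row b b) //.
  by move=> c cD; rewrite ub // cD orbT.
by move=> c cL; rewrite ub ?bL // cL eqxx.
Qed.

Section Direction.
Variable j : 'I_n.
Hypothesis Lj : (L < j)%N.

Let LjF : (L == j) = false. Proof. by apply/negbTE; rewrite neq_ltn Lj. Qed.
Let jLF : (j == L) = false. Proof. by rewrite eq_sym LjF. Qed.

(** The cells of row L whose monomial only involves x_L and x_j receive the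
    coefficients of the form of degree d L dehomogenised to G at x_j = 1. *)
Definition binary_index (k : 'I_N) : option nat :=
  let c := enum_val k in
  if (row_of c == L) && (expo c L + expo c j == d L)%N then Some (expo c L) else None.

(** Adding the power of x_L to row j keeps the forms without common zero on the
    hyperplane x_j = 0 when the other coefficients are those of the pure powers. *)
Definition complete a c : C :=
  if row_of c == L then 0 else if c \in Dset d L.+1 then a c else
  ((row_of c == j) && (expo c L == d j))%:R.

Definition binary a G : 'I_N -> C := coef_subst binary_index (point (complete a)) G.

Definition binary_cell a G c : C :=
  if (row_of c == L) && (expo c L + expo c j == d L)%N then G`_(expo c L) else complete a c.

Lemma binaryE a G (p : {mpoly C[N]}) : p.@[binary a G] = p.@[point (binary_cell a G)].
Proof.
apply: meval_eq => k; rewrite /binary /coef_subst /binary_index /point /binary_cell.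
by case: ifP.
Qed.

Lemma binary_mdeg (i : nat) : (i <= d L)%N -> mdeg (U_(L) *+ i + U_(j) *+ (d L - i))%MM = d L.
Proof. by move=> iL; rewrite mdegD !mdeg_pure subnKC. Qed.

Lemma two_exponents (m : 'X_{1..n}) : (m L + m j)%N = mdeg m ->
  m = (U_(L) *+ m L + U_(j) *+ m j)%MM.
Proof.
rewrite mdegE (bigD1 L) //= (bigD1 j) ?jLF //= addnA => /eqP.
rewrite -[X in X == _]addn0 eqn_add2l eq_sym sum_nat_eq0 => /forallP m0.
apply/mnmP => k; rewrite mnmDE !mulmnE !mnm1E.
have [<-|kL] := eqVneq L k; first by rewrite eq_sym LjF mul1n mul0n addn0.
have [<-|kj] := eqVneq j k; first by rewrite mul1n mul0n add0n.
have := m0 k; rewrite [k == L]eq_sym (negPf kL) [k == j]eq_sym (negPf kj) /= => /eqP ->.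
by rewrite !mul0n.
Qed.

Lemma formv_binary a G x : (size G <= (d L).+1)%N ->
  formv (binary_cell a G) L x = \sum_(i < (d L).+1) G`_i * (x L ^+ i * x j ^+ (d L - i)).
Proof.
move=> Gd; rewrite /formv.
pose h (i : 'I_(d L).+1) : cell d := mkcell (binary_mdeg (leq_ord i)).
have hL i : expo (h i) L = i.
  by rewrite expo_mkcell mnmDE !mulmnE !mnm1E eqxx [j == L]jLF mul1n mul0n addn0.
have hj i : expo (h i) j = (d L - i)%N.
  by rewrite expo_mkcell mnmDE !mulmnE !mnm1E eqxx LjF mul1n mul0n.
have h_row i : row_of (h i) = L by [].
rewrite (bigID (fun c => expo c L + expo c j == d L)%N) /= [X in _ + X]big1 ?addr0; last first.
  move=> c /andP[/eqP cL /negPf cE]; rewrite /binary_cell cL eqxx cE /= /complete cL eqxx.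
  by rewrite mul0r.
rewrite (reindex_onto h (fun c => inord (expo c L))) /=; last first.
  move=> c /andP[/eqP cL /eqP cE]; have cLd : (expo c L < (d L).+1)%N.
    by rewrite ltnS -cE leq_addr.
  apply: cell_inj; rewrite ?cL // expo_mkcell inordK //.
  rewrite [RHS]two_exponents; last by rewrite mdeg_expo cL.
  by congr (_ + _ *+ _)%MM; rewrite -cE addKn.
apply: eq_big => [i|i _]; first by rewrite hL hj subnKC ?leq_ord // !eqxx /= inord_val eqxx.
rewrite /binary_cell h_row hL hj subnKC ?leq_ord // !eqxx /=; congr (_ * _).
rewrite /mono (bigD1 L) //= (bigD1 j) ?jLF //= hL hj big1 ?mulr1 // => k /andP[kL kj].
rewrite expo_mkcell mnmDE !mulmnE !mnm1E [L == k]eq_sym (negPf kL) [j == k]eq_sym (negPf kj).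
by rewrite !mul0n expr0.
Qed.

Lemma formv_binary0 a G x : (size G <= (d L).+1)%N -> x j = 0 ->
  formv (binary_cell a G) L x = G`_(d L) * x L ^+ d L.
Proof.
move=> Gd xj; rewrite formv_binary // big_ord_recr /= subnn expr0 mulr1 big1 ?add0r //.
by move=> i _; rewrite xj expr0n subn_eq0 leqNgt ltn_ord /= !mulr0.
Qed.

Lemma formv_binary_neq0 a G x : (size G <= (d L).+1)%N -> x j != 0 ->
  formv (binary_cell a G) L x = x j ^+ d L * G.[x L / x j].
Proof.
move=> Gd xj; rewrite formv_binary // (horner_coef_wide _ Gd) big_distrr /=.
apply: eq_bigr => i _; rewrite [RHS]mulrCA; congr (_ * _).
rewrite expr_div_n mulrCA; congr (_ * _).
by apply: (mulIf (expf_neq0 i xj)); rewrite mulfVK ?expf_neq0 // -exprD subnK ?leq_ord.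
Qed.

Lemma binary_cell_row a G c (i : 'I_n) : (L < i)%N -> row_of c = i ->
  binary_cell a G c = complete a c.
Proof.
move=> Li ci; have /negPf iL : i != L by rewrite neq_ltn Li orbT.
by rewrite /binary_cell ci iL.
Qed.

Lemma formv_binary_row a b G G' (i : 'I_n) x : (L < i)%N ->
  (forall c, row_of c = i -> mono c x != 0 -> complete a c = complete b c) ->
  formv (binary_cell a G) i x = formv (binary_cell b G') i x.
Proof.
by move=> Li ab; apply: formv_eq => c ci xc; rewrite !(binary_cell_row _ _ Li ci) ab.
Qed.

Section Values.
Variables (p : {mpoly C[N]}) (pR : is_res L p).
Local Notation value a G := p.@[binary a G].

Lemma value_zero a G : value a G = 0 <-> czero L (binary_cell a G).
Proof. by rewrite binaryE; case: pR => pz _ _; apply: pz. Qed.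

(** On the hyperplane x_j = 0 the row L given by G only sees its coefficient of
    x_L ^ (d L), which vanishes if G = 1. *)
Lemma value_roots a G : value a 1 != 0 -> (size G <= (d L).+1)%N ->
  (value a G = 0 <-> exists2 y, (exists x, [/\ x j != 0, x L / x j = y,
     (forall i : 'I_n, (i < L)%N -> x i = 0) &
     (forall i : 'I_n, (L < i)%N -> formv (binary_cell a 1) i x = 0)]) & root G y).
Proof.
move=> v1 Gd; rewrite value_zero; split.
  move=> [x [xn0 x0 ax]].
  have ax' (i : 'I_n) : (L < i)%N -> formv (binary_cell a 1) i x = 0.
    by move=> Li; rewrite -(ax i (ltnW Li)); apply: formv_binary_row.
  have xj : x j != 0.
    apply: contraNneq v1 => xj; apply/eqP/value_zero; exists x; split=> // i.
    rewrite leq_eqVlt => /orP[/eqP/val_inj <-|]; last exact: ax'.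
    rewrite formv_binary0 ?size_poly1 // coef1.
    by rewrite eqn0Ngt d_gt0 mul0r.
  exists (x L / x j); first by exists x.
  have := ax L (leqnn _); rewrite formv_binary_neq0 // => /eqP.
  by rewrite mulf_eq0 expf_eq0 (negPf xj) andbF.
move=> [y [x [xj <- x0 ax] Gy]]; exists x; split=> [||i]; [by exists j|by []|].
rewrite leq_eqVlt => /orP[/eqP/val_inj <-|Li].
  by rewrite formv_binary_neq0 // (rootP Gy) mulr0.
by rewrite -(ax i Li); apply: formv_binary_row.
Qed.

(** This is Res(x_L^d, F') Res(x_j^d, F')^(d-1) = Res(x_L x_j^(d-1), F')^d, the
    multiplicativity of resultants in their first form on this example. *)
Lemma value_power a : value a 1 != 0 ->
  value a 'X^(d L) * value a 1 ^+ (d L).-1 = value a 'X ^+ d L.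
Proof.
move=> v1; have roots G := @value_roots a G v1.
have step k : (k < d L)%N ->
    value a 'X^(k.+1) * value a 1 = value a 'X^k * value a 'X.
  by move=> kd; apply: (multiplicative_on_powers roots).
have powers k : (k <= d L)%N -> value a 'X^k * value a 1 ^+ k = value a 'X ^+ k * value a 1.
  elim: k => [|k IH] kd; first by rewrite !expr0 mulr1 mul1r.
  rewrite [value a 1 ^+ _]exprS mulrA step // mulrAC IH 1?ltnW //.
  by rewrite mulrAC -exprSr.
apply: (mulIf v1); rewrite -powers //.
by rewrite -mulrA -exprSr prednK.
Qed.

Lemma binary_Xd a c : row_of c = L -> binary_cell a 'X^(d L) c = pure c.
Proof.
move=> cL; rewrite /binary_cell cL eqxx /= coefXn /complete cL eqxx /pure is_pureP cL.
have -> : (c == pure_cell d L) = (expo c L == d L).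
  apply/eqP/eqP => [->|cd]; first by rewrite expo_mkcell mulmnE mnm1E eqxx mul1n.
  by apply: cell_inj; rewrite ?cL // expo_mkcell -cL; apply: expo_single; rewrite cL.
case: eqP => // cE; rewrite -[expo c L == _]negbK; case: eqP => // cd.
case: cE; apply/eqP; rewrite cd eqn_leq leq_addr andbT -{2}cL -mdeg_expo mdegE.
by rewrite (bigD1 L) //= (bigD1 j) ?jLF //= cd addnA leq_addr.
Qed.

Lemma value_pure_row a : value a 'X^(d L) = p.@[point (pure_row a)].
Proof.
rewrite binaryE; apply: (res_pure_row pR); [|exact: binary_Xd|].
  move=> c cD; have := Dset_row cD; move=> Lc.
  rewrite (binary_cell_row _ _ Lc (erefl _)) /complete /pure_row cD.
  by have /negPf -> : row_of c != L by rewrite neq_ltn Lc orbT.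
by move=> c cL; rewrite /pure_row cL eqxx.
Qed.

(** With x_j = 0 imposed by row L, only the cells free of x_j matter. *)
Lemma value1_dep a b :
  (forall c, c \in Dset d L.+1 -> expo c j = 0%N -> a c = b c) -> value a 1 = value b 1.
Proof.
move=> ab; rewrite !binaryE.
apply: (@res_dep _ _ _ L p (fun c => (row_of c == L) || (expo c j == 0%N))) => //.
  move=> c cS; rewrite /binary_cell; case: ifP => // cLj.
  rewrite /complete; case: ifP => // cL; case: ifP => // cD; apply/esym/ab => //.
  by move: cS; rewrite cL => /eqP.
move=> u ub.
have zero_j x : formv u L x = 0 -> x j = 0.
  rewrite (_ : formv u L x = x j ^+ d L); first by move/eqP; rewrite expf_eq0 => /andP[_ /eqP].
  rewrite (_ : formv u L x = formv (binary_cell b 1) L x).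
    rewrite formv_binary ?size_poly1 // big_ord_recl coef1 /= mul1r expr0 mul1r subn0.
    by rewrite big1 ?addr0 // => i _; rewrite coef1 /= mul0r.
  by apply: formv_eq => c cL _; rewrite ub // cL eqxx.
suff zero_imp v w : (forall c, (row_of c == L) || (expo c j == 0%N) -> v c = w c) ->
    (forall x, formv v L x = 0 -> x j = 0) -> czero L v -> czero L w.
  have b_zero_j x : formv (binary_cell b 1) L x = 0 -> x j = 0.
    by move=> bx; apply: zero_j; rewrite -bx; apply: formv_eq => c cL _; rewrite ub // cL eqxx.
  by split; apply: zero_imp => // c cS; rewrite ub.
move=> vw v_zero_j [x [xn0 x0 vx]]; exists x; split=> // i Li; rewrite -(vx i Li).
apply: formv_eq => c ci xc; apply/esym/vw; apply/orP; right.
by apply: contraR xc => cj; apply/eqP/(@mono0 _ _ _ c x j) => //; apply/v_zero_j/vx.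
Qed.

(** The forms x_j^d, x_i^(d i) for i different from j, and x_j^(d j) + x_L^(d j)
    only vanish simultaneously at 0. *)
Lemma value1_pure : value pure 1 != 0.
Proof.
apply/eqP => /value_zero[x [[k xk] x0 ax]].
have xj : x j = 0.
  have := ax L (leqnn _); rewrite formv_binary ?size_poly1 // big_ord_recl coef1 /= mul1r.
  rewrite expr0 mul1r subn0 big1 ?addr0 => [/eqP|i _]; last by rewrite coef1 /= mul0r.
  by rewrite expf_eq0 => /andP[_ /eqP].
have pure_Dset c : (L < row_of c)%N -> c \notin Dset d L.+1 -> pure c = 0.
  move=> Lc; rewrite /pure is_pureP; case: eqP => // -> /negP[]; apply/DsetP.
  rewrite row_mkcell; split=> // i iL; rewrite expo_mkcell mulmnE mnm1E.
  case: eqP => // ri; move: iL; rewrite -ri ltnS leqNgt Lc //.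
have xi (i : 'I_n) : (L < i)%N -> x i = 0.
  move=> Li; have [->//|ij] := eqVneq i j.
  have := ax i (ltnW Li); rewrite formv_pure_row => [/eqP|c ci].
    by rewrite expf_eq0 => /andP[_ /eqP].
  rewrite (binary_cell_row _ _ Li ci) /complete ci (negPf ij) /=.
  have /negPf -> : i != L by rewrite neq_ltn Li orbT.
  by case: ifP => // /negbT cD; rewrite pure_Dset ?ci.
have xL : x L = 0.
  have := ax j (ltnW Lj); pose c0 := mkcell (etrans (mdeg_pure L (d j)) (erefl (d j))).
  have c0L : expo c0 L = d j by rewrite expo_mkcell mulmnE mnm1E eqxx mul1n.
  rewrite (@formv_single _ _ _ _ j x c0) // => [|c cj cc0].
    rewrite (binary_cell_row _ _ Lj) // /complete row_mkcell jLF c0L !eqxx /=.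
    rewrite ifN; last first.
      apply/negP => /Dset_expo/(_ (leqnn _)); rewrite c0L => /eqP.
      by rewrite eqn0Ngt d_gt0.
    rewrite mul1r /mono (bigD1 L) //= c0L => /eqP; rewrite mulf_eq0.
    rewrite expf_eq0 => /orP[/andP[_ /eqP]|] //; rewrite big1 ?oner_eq0 // => i iL.
    by rewrite expo_mkcell mulmnE mnm1E eq_sym (negPf iL) mul0n expr0.
  rewrite (binary_cell_row _ _ Lj) // /complete cj jLF eqxx /=; case: ifP => cD.
    rewrite /pure is_pureP cj; case: eqP => [->|]; last by rewrite mul0r.
    by rewrite mul1r mono_pure xj expr0n eqn0Ngt d_gt0.
  case: eqP => [cL|]; last by rewrite mul0r.
  case/eqP: cc0; apply: cell_inj; rewrite ?cj // expo_mkcell.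
  by rewrite (@expo_single _ _ c L) ?cj.
case/eqP: xk; have [/x0 //|Lk|/val_inj ->//] := ltngtP k L; exact: xi.
Qed.

(** Coordinates centred at the pure powers, around which roots are extracted. *)
Definition shift (v : 'I_N -> C) c : C := pure c + v (enum_rank c).

Definition binary_var G (k : 'I_N) : {mpoly C[N]} :=
  let c := enum_val k in
  if binary_index k is Some i then (G`_i)%:MP else
  if row_of c == L then 0 else if c \in Dset d L.+1 then 'X_k + (pure c)%:MP else
  ((row_of c == j) && (expo c L == d j))%:R%:MP.

Definition binary_poly G : {mpoly C[N]} := p \mPo [tuple binary_var G k | k < N].

Lemma binary_poly_eval G v : (binary_poly G).@[v] = value (shift v) G.
Proof.
rewrite comp_mpoly_meval; apply: meval_eq => k; rewrite tnth_mktuple.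
rewrite /binary /coef_subst /binary_var; case: binary_index => [i|]; first by rewrite mevalC.
rewrite /point /complete; case: ifP => _; first by rewrite meval0.
case: ifP => _; last by rewrite mevalC.
by rewrite mevalD mevalXU mevalC /shift enum_valK addrC.
Qed.

Lemma shift0 : shift (fun=> 0) = pure.
Proof. by apply: funext => c; rewrite /shift addr0. Qed.

(** The variables that the resultant with first form x_j^d cannot involve. *)
Definition foreign (k : 'I_N) : bool :=
  (enum_val k \notin Dset d L.+1) || (expo (enum_val k) j != 0%N).

Lemma binary_poly1_vdeg : vdeg_le foreign 0 (binary_poly 1).
Proof.
apply: vdeg_le0_fun; first by rewrite -meval0_mcoeff binary_poly_eval shift0 value1_pure.
move=> v w vw; rewrite !binary_poly_eval; apply: value1_dep => c cD cj.
by rewrite /shift vw // /foreign enum_rankK cD cj.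
Qed.

Lemma binary_poly_power :
  binary_poly 'X^(d L) * binary_poly 1 ^+ (d L).-1 = binary_poly 'X ^+ d L.
Proof.
have b1 : binary_poly 1 != 0.
  by apply: contraNneq value1_pure => b1; rewrite -shift0 -binary_poly_eval b1 meval0.
apply: (mulfI b1); apply: mpoly_eq_fun => v; rewrite !mevalM !rmorphXn /= !binary_poly_eval.
have [->|v1] := eqVneq (value (shift v) 1) 0; first by rewrite !mul0r.
by rewrite value_power.
Qed.

End Values.
End Direction.

(** The identities [value_power], one for each direction j > L, satisfy the
    assumptions of [polynomial_root]: a cell of the next level has a nonzero exponent
    in some direction j, so it is foreign to the corresponding resultant. *)
Lemma res_descent p : is_res L p -> (L.+1 < n)%N ->
  exists2 p', is_res L.+1 p' & forall a, p.@[point (pure_row a)] = p'.@[point a] ^+ d L.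
Proof.
move=> pR Ln; pose J := {j : 'I_n | (L < j)%N}.
pose j0 : J := exist (fun j : 'I_n => L < j)%N (Ordinal Ln) (leqnn _).
pose q := binary_poly (val j0) p 'X^(d L).
have q_eval v : q.@[v] = p.@[point (pure_row (shift v))].
  by rewrite binary_poly_eval value_pure_row //; apply: (valP j0).
have qE (j : J) : binary_poly (val j) p 'X^(d L) = q.
  apply: mpoly_eq_fun => v; rewrite q_eval binary_poly_eval value_pure_row //.
  exact: (valP j).
have pure_row_pure : pure_row pure = pure by apply: funext => c; rewrite /pure_row if_same.
have q0 : q.@[fun=> 0] = 1 by rewrite q_eval shift0 pure_row_pure; case: pR.
(* The constants c1 and cX normalise the constant terms to 1. *)
pose c1 (j : J) := (binary_poly (val j) p 1).@[fun=> 0].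
pose cX (j : J) := (binary_poly (val j) p 'X).@[fun=> 0].
have c1n0 j : c1 j != 0.
  by rewrite /c1 binary_poly_eval shift0 value1_pure //; apply: (valP j).
have power (j : J) : q * binary_poly (val j) p 1 ^+ (d L).-1 = binary_poly (val j) p 'X ^+ d L.
  by rewrite -(qE j) binary_poly_power //; apply: (valP j).
have cXE j : cX j ^+ d L = c1 j ^+ (d L).-1.
  by rewrite /cX -rmorphXn -power /= rmorphM rmorphXn /= q0 mul1r.
have cXn0 j : cX j != 0.
  apply: contraTneq (expf_neq0 (d L).-1 (c1n0 j)) => cX0.
  by rewrite -cXE cX0 expr0n eqn0Ngt d_gt0 eqxx.
pose g (j : J) := (cX j)^-1 *: binary_poly (val j) p 'X.
pose w (j : J) := ((c1 j)^-1 *: binary_poly (val j) p 1) ^+ (d L).-1.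
(* Here g is the resultant for x_L x_j^(d-1) and w the power of the one for x_j^d. *)
have [||||| f fq f0] := @polynomial_root C N J j0 (fun j => foreign (val j)) (d L) q g w (d_gt0 L).
- move=> k; have [kD|kD] := boolP (enum_val k \in Dset d L.+1); last first.
    by exists j0; rewrite /foreign kD.
  case: (pickP (fun i => expo (enum_val k) i != 0%N)) => [i ki|k0].
    have Li : (L < i)%N by rewrite ltnNge; apply: contra ki => iL; rewrite (Dset_expo kD).
    by exists (exist _ i Li); rewrite /foreign ki orbT.
  have := d_gt0 (row_of (enum_val k)); rewrite -mdeg_expo mdegE big1 // => i _.
  by apply/eqP/negPn; rewrite k0.
- by move=> j; rewrite -meval0_mcoeff mevalZ mulVf.
- by move=> j; rewrite -meval0_mcoeff rmorphXn /= mevalZ mulVf ?expr1n.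
- move=> j; rewrite -[0%N](muln0 (d L).-1); apply/vdeg_leX/vdeg_leZ.
  by apply: binary_poly1_vdeg => //; apply: (valP j).
- move=> j; rewrite /g /w !exprZn -power -scalerAr !exprVn; by rewrite cXE.
(* The root was computed around the pure powers: translate back. *)
pose p' := f \mPo [tuple 'X_k - (pure (enum_val k))%:MP | k < N].
have p'_eval a : p'.@[point a] = f.@[fun k => a (enum_val k) - pure (enum_val k)].
  rewrite comp_mpoly_meval; apply: meval_eq => k.
  by rewrite tnth_mktuple mevalB mevalXU mevalC.
have p'_power a : p.@[point (pure_row a)] = p'.@[point a] ^+ d L.
  rewrite p'_eval -rmorphXn fq /= q_eval; congr (_.@[point (pure_row _)]).
  by apply: funext => c; rewrite /shift enum_rankK addrC subrK.
have p'_zero a : p'.@[point a] = 0 <-> czero L.+1 a.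
  rewrite -(@czero_pure_row (pure_row a) a).
  - case: pR => <- _ _; rewrite p'_power; split=> [->|/eqP]; first by rewrite expr0n eqn0Ngt d_gt0.
    by rewrite expf_eq0 => /andP[_ /eqP].
  - move=> c /Dset_row Lc; rewrite /pure_row ifN //.
    by rewrite neq_ltn Lc orbT.
  - by move=> c cL; rewrite /pure_row cL eqxx.
have p'_pure : p'.@[point pure] = 1.
  rewrite p'_eval -f0 -meval0_mcoeff; apply: meval_eq => k.
  by rewrite subrr.
exists p' => //; split=> // i m Li mp.
(* The degree of p' in row i is the degree of its d-th power divided by d. *)
have [w' p'w] := zero_weight p'_zero (@czero_scale_rows _ _ _ L.+1 (fun k => k == i : nat)).
have <- : w' = delta d L.+1 i; last by rewrite -row_weight p'w.
have := meval_weight 2%:R pure p'w; rewrite p'_pure mulr1 => p'2.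
have pw m' : m' \in msupp p -> (\sum_c (row_of c == i) * m' (enum_rank c) = delta d L i)%N.
  by case: pR => _ p_row _ /p_row; rewrite row_weight => -> //; apply: ltnW.
have := meval_weight 2%:R pure pw; case: pR => _ _ ->; rewrite mulr1.
have /negPf iL : i != L by rewrite neq_ltn Li orbT.
have -> : p.@[point (fun c => 2%:R ^+ (row_of c == i) * pure c)] = (2%:R ^+ w') ^+ d L.
  rewrite -p'2 -p'_power; congr (_.@[point _]); apply: funext => c; rewrite /pure_row.
  by case: (row_of c =P L) => [->|//]; rewrite [L == i]eq_sym iL mul1r.
rewrite -exprM => /exprn2_inj; rewrite /delta Li ltnW //.
rewrite (bigD1 L) /=; last by rewrite leqnn eq_sym iL.
rewrite mulnC => /eqP; rewrite eqn_pmul2l // => /eqP ->; apply: eq_bigl => k.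
by rewrite ltn_neqAle [L == k :> nat]eq_sym val_eqE; case: (k == L); rewrite ?andbF ?andbT.
Qed.
End Descent.

(** * Coefficients indexed by fillings *)

Lemma Posz_sum (I : Type) (r : seq I) (P : pred I) (F : I -> nat) :
  Posz (\sum_(i <- r | P i) F i)%N = \sum_(i <- r | P i) (F i)%:Z.
Proof. exact: (big_morph Posz PoszD). Qed.

Section Fillings.
Variables (n : nat) (d : 'I_n -> nat).
Local Notation N := #|{: cell d}|.
Implicit Types (A B : filling d) (c : cell d).

Definition mnm_of A : 'X_{1..N} := [multinom `|A (enum_val k)|%N | k < N].
Definition fill_of (m : 'X_{1..N}) : filling d := [ffun c => (m (enum_rank c))%:Z].

Lemma mnm_ofE A c : mnm_of A (enum_rank c) = `|A c|%N.
Proof. by rewrite mnmE enum_rankK. Qed.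

Lemma fill_ofK m : mnm_of (fill_of m) = m.
Proof. by apply/mnmP => k; rewrite mnmE ffunE enum_valK. Qed.

Lemma mnm_ofK A : effective A -> fill_of (mnm_of A) = A.
Proof.
by move=> /forallP A0; apply/ffunP => c; rewrite ffunE mnm_ofE gez0_abs.
Qed.

Lemma fil_effective (A : bfilling d) : effective A.
Proof. by apply/forallP => c; rewrite ffunE. Qed.

Lemma fil_inj : injective (@fil n d).
Proof.
move=> A B /ffunP AB; apply/ffunP => c; apply: val_inj.
by have := AB c; rewrite !ffunE => -[].
Qed.

Lemma REF_effective l A : REF l A -> effective A.
Proof. by case/and4P. Qed.

Lemma REF_ge0 l A c : REF l A -> 0 <= A c.
Proof. by move=> /REF_effective/forallP. Qed.

Lemma REF_supp l A c : REF l A -> A c != 0 -> c \in Dset d l.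
Proof. by move=> /and4P[_ /forallP/(_ c)/implyP]. Qed.

Lemma REF_supp0 l A c : REF l A -> c \notin Dset d l -> A c = 0.
Proof. by move=> RA; apply: contraNeq => /(REF_supp RA). Qed.

Lemma REF_row l A i : REF l A -> frow A i = (delta d l i)%:Z.
Proof. by move=> /and4P[_ _ /forallP/(_ i)/eqP]. Qed.

Lemma REF_wt l A (j : 'I_n) : REF l A -> (l <= j)%N ->
  fwt A j = (\prod_(k < n | (l <= k)%N) d k)%N%:Z.
Proof. by move=> /and4P[_ _ _ /forallP/(_ j)/eqP ->] ->. Qed.

Lemma delta_mul l (i : 'I_n) : (l <= i)%N ->
  (d i * delta d l i = \prod_(k < n | (l <= k)%N) d k)%N.
Proof. by move=> li; rewrite /delta li [RHS](bigD1 i). Qed.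

(** The conditions on the rows and variables below l follow from the support. *)
Lemma REFP l A : effective A -> (forall c, c \notin Dset d l -> A c = 0) ->
  (forall i : 'I_n, (l <= i)%N -> frow A i = (delta d l i)%:Z) ->
  (forall j : 'I_n, (l <= j)%N -> fwt A j = (d j * delta d l j)%N%:Z) -> REF l A.
Proof.
move=> A0 supp row wt; apply/and4P; split=> //.
- by apply/forallP => c; apply/implyP; apply: contraR => /supp ->.
- apply/forallP => i; have [li|il] := leqP l i; first by rewrite row.
  rewrite /delta leqNgt il /= /frow big1 // => c /eqP ci; apply: supp.
  by apply: contraL il => /Dset_row; rewrite ci -leqNgt.
apply/forallP => j; have [lj|jl] := leqP l j; first by rewrite wt // delta_mul.
rewrite /fwt big1 // => c _; have [cD|/supp ->] := boolP (c \in Dset d l).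
  by rewrite (Dset_expo cD) // mulr0.
by rewrite mul0r.
Qed.

Lemma fmonomE (R : realType) A : fmonom R A = 'X_[mnm_of A].
Proof.
rewrite /fmonom mpolyXE_id [RHS](reindex (@enum_rank (cell d))) /=.
  by apply: eq_bigr => c _; rewrite mnm_ofE.
by exists enum_val => k _; [apply: enum_rankK|apply: enum_valK].
Qed.

Lemma meval_mnm_of (R : comNzRingType) (v : 'I_N -> R) A :
  ('X_[mnm_of A]).@[v] = \prod_c v (enum_rank c) ^+ `|A c|%N.
Proof.
rewrite mevalX (reindex (@enum_rank (cell d))) /=.
  by apply: eq_bigr => c _; rewrite mnm_ofE.
by exists enum_val => k _; [apply: enum_rankK|apply: enum_valK].
Qed.

Section Resultant.
Variable (C : numClosedFieldType).

Lemma res_REF l (p : {mpoly C[N]}) m : is_res l p -> m \in msupp p -> REF l (fill_of m).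
Proof.
move=> pR mp; apply: REFP => [|c cD|i li|j lj].
- by apply/forallP => c; rewrite ffunE.
- by rewrite ffunE (res_supp pR mp cD).
- case: pR => _ /(_ i m li mp) <- _; rewrite /frow Posz_sum.
  by apply: eq_bigr => c _; rewrite ffunE.
rewrite -(res_expo pR lj mp) /fwt Posz_sum; apply: eq_bigr => c _.
by rewrite ffunE -PoszM mulnC.
Qed.

Definition coef (p : {mpoly C[N]}) A : C := p@_(mnm_of A).

Hypothesis d_gt0 : forall i, (0 < d i)%N.

Lemma res_expand l (p : {mpoly C[N]}) : is_res l p ->
  p = \sum_(A : bfilling d | REF l A) coef p A *: 'X_[mnm_of A].
Proof.
move=> pR; apply/mpolyP => m; rewrite raddf_sum /=.
have [mp|mp] := boolP (m \in msupp p).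
  have mR := res_REF pR mp; have [B mB] := REF_bfilling d_gt0 mR.
  rewrite (bigD1 B) /=; last by rewrite -mB.
  rewrite mcoeffZ mcoeffX -mB fill_ofK eqxx mulr1 /coef fill_ofK.
  rewrite big1 ?addr0 // => A /andP[_ AB]; rewrite mcoeffZ mcoeffX.
  case: eqP => [Am|]; last by rewrite mulr0.
  case/eqP: AB; apply: fil_inj; rewrite -mB -Am mnm_ofK //; exact: fil_effective.
rewrite (memN_msupp_eq0 mp) big1 // => A _; rewrite mcoeffZ mcoeffX.
by case: eqP => [Am|]; rewrite ?mulr0 // /coef Am (memN_msupp_eq0 mp) mul0r.
Qed.

Lemma meval_res l p (v : 'I_N -> C) : is_res l p ->
  p.@[v] = \sum_(A : bfilling d | REF l A) coef p A * \prod_c v (enum_rank c) ^+ `|fil A c|%N.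
Proof.
move=> pR; rewrite {1}(res_expand pR) raddf_sum /=; apply: eq_bigr => A _.
by rewrite mevalZ meval_mnm_of.
Qed.

End Resultant.
End Fillings.

(** * The multinomial theorem by rows *)

Lemma mcoeff_mnmM (R : comNzRingType) N u (q : {mpoly R[N]}) m :
  ('X_[u] * q)@_m = if (u <= m)%MM then q@_(m - u)%MM else 0.
Proof.
case: ifPn => um; first by rewrite mulrC -[in LHS](submK um) addmC mcoeffMX.
rewrite mcoeffM big1 // => -[k1 k2] /= /eqP mE; rewrite mcoeffX.
case: eqP => [k1E|]; last by rewrite mul0r.
by case/negP: um; rewrite k1E [X in (_ <= X)%MM]mE lem_addr.
Qed.

Lemma mcoeffXM (R : comNzRingType) N (k : 'I_N) (q : {mpoly R[N]}) m :
  ('X_k * q)@_m = if m k == 0%N then 0 else q@_(m - U_(k))%MM.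
Proof. by rewrite mcoeff_mnmM lep1mP if_neg. Qed.

Definition mfact N (m : 'X_{1..N}) := (\prod_(k < N) (m k)`!)%N.

Lemma mfactB1 N (m : 'X_{1..N}) k : m k != 0%N -> mfact m = (m k * mfact (m - U_(k))%MM)%N.
Proof.
move=> mk; rewrite /mfact (bigD1 k) //= [in RHS](bigD1 k) //= mulnA; congr muln.
  by rewrite mnmBE mnm1E eqxx subn1 -{1}(prednK (n := m k)) ?lt0n // factS prednK ?lt0n.
by apply: eq_bigr => i ik; rewrite mnmBE mnm1E eq_sym (negPf ik) subn0.
Qed.

(** The multinomial theorem for a product of powers of sums of disjoint sets of
    variables, one for each row. *)
Lemma mcoeff_prod_row_sums (R : comNzRingType) n N (row : 'I_N -> 'I_n) (S : pred 'I_N)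
    (rho : 'I_n -> nat) (m : 'X_{1..N}) :
  (forall k, m k != 0%N -> S k) -> (forall i, \sum_(k | row k == i) m k = rho i)%N ->
  (\prod_(i < n) (\sum_(k | S k && (row k == i)) 'X_k : {mpoly R[N]}) ^+ rho i)@_m *+ mfact m
  = (\prod_(i < n) (rho i)`!)%N%:R.
Proof.
move Es : (\sum_i rho i)%N => s; elim: s rho m Es => [|s IH] rho m Es mS m_row.
  have rho0 i : rho i = 0%N.
    by apply/eqP; move/eqP: Es; rewrite sum_nat_eq0 => /forallP/(_ i).
  have -> : m = 0%MM.
    apply/mnmP => k; rewrite mnm0E; apply/eqP.
    by have /eqP := m_row (row k); rewrite rho0 sum_nat_eq0 => /forallP/(_ k)/implyP ->.
  rewrite big1 => [|i _]; last by rewrite rho0.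
  rewrite mcoeff1 eqxx /mfact big1 => [|k _]; last by rewrite mnm0E.
  by rewrite big1 // => i _; rewrite rho0.
have [i0 rho_i0] : exists i, rho i != 0%N.
  case: (pickP (fun i => rho i != 0%N)) => [i ?|rho0]; first by exists i.
  by move: Es; rewrite big1 // => i _; apply/eqP/negPn; rewrite rho0.
pose rho' i := (rho i - (i == i0))%N.
have rhoE i : rho i = (rho' i + (i == i0))%N.
  by rewrite /rho'; case: eqP => [->|_]; rewrite ?subnK ?lt0n // subn0 addn0.
have rho's : (\sum_i rho' i = s)%N.
  apply/eqP; rewrite -(eqn_add2r 1) [(s + 1)%N]addn1 -Es [X in _ == X](eq_bigr _ (fun i _ => rhoE
    i)) big_split /=.
  by rewrite eqn_add2l (bigD1 i0) //= eqxx big1 // => i /negPf ->.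
pose Y i : {mpoly R[N]} := \sum_(k | S k && (row k == i)) 'X_k.
rewrite -[X in X@__]/(\prod_i Y i ^+ rho i).
have -> : \prod_i Y i ^+ rho i = Y i0 * \prod_i Y i ^+ rho' i.
  rewrite (eq_bigr (fun i => Y i ^+ (i == i0) * Y i ^+ rho' i)); last first.
    by move=> i _; rewrite rhoE addnC exprD.
  rewrite big_split /= (bigD1 i0) //= eqxx big1 ?mulr1 // => i /negPf ->; exact: expr0.
rewrite big_distrl /= raddf_sum /= -sumrMnl.
rewrite (eq_bigr (fun k => (m k)%:R * (\prod_i (rho' i)`!)%N%:R)); last first.
  move=> k /andP[Sk /eqP rk]; rewrite mcoeffXM; case: eqP => [->|/eqP mk].
    by rewrite mul0rn mul0r.
  rewrite (mfactB1 mk) mulnC mulrnA IH // ?mulr_natl //.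
    by move=> k'; rewrite mnmBE => H; apply: mS; apply: contraNneq H => ->.
  move=> i; apply/eqP; rewrite -(eqn_add2r (i == i0)) -rhoE -m_row.
  rewrite [X in _ == X](eq_bigr (fun k' => (m - U_(k))%MM k' + (k' == k)))%N; last first.
    move=> k' _; rewrite mnmBE mnm1E eq_sym; case: eqP => [->|_]; last by rewrite subn0 addn0.
    by rewrite subnK // lt0n.
  rewrite big_split /= eqn_add2l; have [->|ii0] := eqVneq i i0.
    by rewrite (bigD1 k) ?rk //= eqxx big1 // => k' /andP[_ /negPf ->].
  by rewrite big1 // => k' /eqP; case: eqP => // -> rki; rewrite -rki rk eqxx in ii0.
rewrite -big_distrl /= -natr_sum -natrM; congr _%:R.
have -> : (\sum_(k | S k && (row k == i0)) m k = rho i0)%N.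
  rewrite -m_row [RHS](bigID S) /= [X in (_ + X)%N]big1 ?addn0.
    by apply: eq_bigl => k; rewrite andbC.
  by move=> k /andP[_ nS]; apply/eqP; apply: contraR nS; apply: mS.
rewrite (bigD1 i0) //= [RHS](bigD1 i0) //= mulnA; congr muln.
  by rewrite [rho i0]rhoE eqxx addn1 factS.
by apply: eq_bigr => i /negPf ii0; rewrite [rho i]rhoE ii0 addn0.
Qed.

(** * Linear relations between the coefficients *)

Lemma comp_mpoly_sumX (R : comNzRingType) N M (I : Type) (r : seq I) (P : pred I)
    (F : I -> R) (m : I -> 'X_{1..N}) (lq : N.-tuple {mpoly R[M]}) :
  (\sum_(i <- r | P i) F i *: 'X_[m i]) \mPo lq =
  \sum_(i <- r | P i) F i *: \prod_(k < N) tnth lq k ^+ m i k.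
Proof.
by rewrite raddf_sum; apply: eq_bigr => i _; rewrite /= comp_mpolyZ comp_mpolyX.
Qed.

Section Relation.
Variables (n : nat) (d : 'I_n -> nat).
Hypothesis d_gt0 : forall i, (0 < d i)%N.
Local Notation N := #|{: cell d}|.
Implicit Types (A B : filling d) (c : cell d).
Variable L : 'I_n.
Hypothesis Ln : (L.+1 < n)%N.

Local Notation E := (Eset d L).
Local Notation T := (Tset d L).
Local Notation S := (Dset d L :\: E).

Lemma EsetE c : (c \in E) = (L <= row_of c)%N && is_pure c.
Proof. by rewrite inE evecE. Qed.

Lemma Eset_cell c : c \in E -> c = pure_cell d (row_of c).
Proof. by rewrite EsetE is_pureP => /andP[_ /eqP]. Qed.

Lemma pure_cell_E (i : 'I_n) : (L <= i)%N -> pure_cell d i \in E.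
Proof. by move=> Li; rewrite EsetE is_pureP eqxx Li. Qed.

Lemma E_sub_D c : c \in E -> c \in Dset d L.
Proof.
move=> cE; have := cE; rewrite EsetE => /andP[Lc _]; apply/DsetP; split=> // j jL.
rewrite (Eset_cell cE) expo_mkcell mulmnE mnm1E; case: eqP => // cj.
by move: jL; rewrite -cj ltnNge Lc.
Qed.

(** The exponent of the cell of T in row i. *)
Definition tmon (i : 'I_n) : 'X_{1..n} :=
  if (i.+1 < n)%N then (evec n L *+ (d i).-1 + evec n i.+1)%MM else (evec n L *+ d i)%MM.

Lemma mdeg_tmon i : mdeg (tmon i) = d i.
Proof.
rewrite /tmon; case: ifP => [i1|_]; last by rewrite evecE mdeg_pure.
by rewrite mdegD (evecE (Ordinal i1)) evecE mdeg_pure mdeg1 addn1 prednK.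
Qed.

Definition tcell i : cell d := mkcell (mdeg_tmon i).

Lemma TsetE c : (c \in T) = (L <= row_of c)%N && (c == tcell (row_of c)).
Proof.
rewrite inE -/(tmon (row_of c)); congr (_ && _).
by apply/eqP/eqP => [H|->]; [apply: cell_inj|rewrite expo_mkcell].
Qed.

Lemma evecnE k (j : 'I_n) : evec n k j = (j == k :> nat). Proof. by rewrite mnmE. Qed.

Lemma tmon_ne_pure (i : 'I_n) : (L <= i)%N -> tmon i != (U_(i) *+ d i)%MM.
Proof.
move=> Li; apply/eqP => /mnmP tE; have := tE i; rewrite mulmnE mnm1E eqxx mul1n /tmon.
case: ifP => [i1|i1].
  rewrite mnmDE mulmnE !evecnE; have := d_gt0 i; rewrite (ltn_eqF (ltnSn i)) addn0.
  by case: (i == L :> nat) (d i) => [] [|k] //=; rewrite ?mul1n ?mul0n // => _ /n_Sn.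
rewrite mulmnE evecnE; have /negPf -> : i != L :> nat.
  by apply: contraFneq i1 => ->.
by rewrite mul0n => /eqP; rewrite eq_sym eqn0Ngt d_gt0.
Qed.

(** The inequality L + 1 < n keeps the cells of T away from the pure ones: with a
    single variable left, the two cells of the last row would coincide. *)
Lemma T_sub_S c : c \in T -> c \in S.
Proof.
rewrite TsetE => /andP[Lc /eqP cT]; rewrite inE EsetE Lc /=; apply/andP; split.
  by rewrite cT /is_pure expo_mkcell row_mkcell tmon_ne_pure.
apply/DsetP; split=> // j jL; rewrite cT expo_mkcell /tmon.
have jLF : (j == L :> nat) = false by apply: ltn_eqF.
case: ifP => _; last by rewrite mulmnE evecnE jLF.
rewrite mnmDE mulmnE !evecnE jLF mul0n add0n.
by rewrite ltn_eqF // ltnS (leq_trans (ltnW jL)).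
Qed.

Lemma frow_P A (i : 'I_n) : (L <= i)%N -> frow (Pfill L A) i = frow A i.
Proof.
move=> Li; rewrite {1}/frow (bigD1 (tcell i)) //= ffunE row_mkcell TsetE Li eqxx mulr1.
rewrite big1 ?addr0 // => c /andP[/eqP ci ct]; rewrite ffunE TsetE ci.
by rewrite (negPf ct) andbF mulr0.
Qed.

Lemma maskE (X : {set cell d}) A c : fmask X A c = if c \in X then A c else 0.
Proof. by rewrite ffunE; case: ifP; rewrite ?mul1r ?mul0r. Qed.

Lemma mask_effective X A : effective A -> effective (fmask X A).
Proof. by move=> /forallP A0; apply/forallP => c; rewrite maskE; case: ifP. Qed.

Lemma frow_ge0 A i : effective A -> 0 <= frow A i.
Proof. by move=> /forallP A0; apply: sumr_ge0. Qed.

Lemma P_effective A : effective A -> effective (Pfill L A).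
Proof. by move=> A0; apply/forallP => c; rewrite ffunE mulr_ge0 ?frow_ge0 ?ler0n. Qed.

Lemma frowD A B i : frow (A + B) i = frow A i + frow B i.
Proof. by rewrite /frow -big_split; apply: eq_bigr => c _; rewrite ffunE. Qed.

Lemma frow_split A i : (forall c, c \notin Dset d L -> A c = 0) ->
  frow A i = frow (fmask S A) i + frow (fmask E A) i.
Proof.
move=> A0; rewrite -frowD; apply: eq_bigr => c _; rewrite ffunE !maskE inE.
have [cD|cD] := boolP (c \in Dset d L); first by case: (c \in E); rewrite ?addr0 ?add0r.
rewrite andbF add0r; case: ifP => [/E_sub_D cD'|_]; last exact: A0.
by rewrite cD' in cD.
Qed.

Lemma fnorm_row A : fnorm A = \sum_(i < n) frow A i.
Proof. by rewrite /fnorm (partition_big (@row_of n d) predT). Qed.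

Section Resultant.
Variables (C : numClosedFieldType) (p : {mpoly C[N]}).
Hypothesis pR : is_res L p.

Definition row_sum (i : 'I_n) : {mpoly C[N]} :=
  \sum_(k < N | (enum_val k \in S) && (row_of (enum_val k) == i)) 'X_k.

(** Forms with the common zero (0, .., 0, 1, .., 1): the coefficients on E are
    determined by the others. *)
Definition vanishing_var (k : 'I_N) : {mpoly C[N]} :=
  if enum_val k \in E then - row_sum (row_of (enum_val k)) else 'X_k.

Lemma res_vanishing : p \mPo [tuple vanishing_var k | k < N] = 0.
Proof.
apply: mpoly_fun0 => v; rewrite comp_mpoly_meval.
pose a c : C := if c \in E then
  - \sum_(c' | (c' \in S) && (row_of c' == row_of c)) v (enum_rank c') else v (enum_rank c).
have -> : p.@[fun k => (tnth [tuple vanishing_var k | k < N] k).@[v]] = p.@[point a].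
  apply: meval_eq => k; rewrite tnth_mktuple /point /vanishing_var /a.
  case: ifP => _; last by rewrite mevalXU enum_valK.
  rewrite mevalN /row_sum (raddf_sum (meval v)) (reindex (@enum_rank (cell d))).
    by congr (- _); apply: eq_big => c; [rewrite enum_rankK|move=> _; apply: mevalXU].
  by exists enum_val => c _; [apply: enum_rankK|apply: enum_valK].
case: pR => pz _ _; apply/pz; pose x (j : 'I_n) : C := (L <= j)%:R.
exists x; split=> [|j jL|i Li].
- by exists L; rewrite /x leqnn oner_eq0.
- by rewrite /x leqNgt jL.
have x1 c : c \in Dset d L -> mono c x = 1.
  move=> cD; rewrite /mono big1 // => j _; rewrite /x.
  by case: leqP => [_|jL]; rewrite ?expr1n // (Dset_expo cD).
have x0 c : row_of c = i -> c \notin Dset d L -> mono c x = 0.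
  by move=> ci; apply: mono_Dset; [move=> j jL; rewrite /x leqNgt jL|rewrite ci].
rewrite /formv (bigD1 (pure_cell d i)) //= x1 ?E_sub_D ?pure_cell_E // mulr1.
rewrite {1}/a pure_cell_E // row_mkcell; apply/eqP; rewrite addrC subr_eq0; apply/eqP.
rewrite big_mkcond [RHS]big_mkcond; apply: eq_bigr => c _; have [ci|] /= := eqP;
  last by rewrite andbF.
rewrite andbT inE EsetE ci Li is_pureP ci /= andbC.
have [cD|cD] := boolP (c \in Dset d L) => /=; last by rewrite x0 // mulr0 if_same.
by case: ifPn => // cp; rewrite x1 // mulr1 /a ifN // EsetE ci Li is_pureP ci.
Qed.

Definition Erow A (i : 'I_n) : nat := (\sum_(c | row_of c == i) `|fmask E A c|)%N.

Lemma frow_nat A i : effective A -> frow A i = (\sum_(c | row_of c == i) `|A c|)%N%:Z.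
Proof.
by move=> /forallP A0; rewrite Posz_sum; apply: eq_bigr => c _; rewrite gez0_abs.
Qed.

Lemma frow_Erow A i : effective A -> frow (fmask E A) i = (Erow A i)%:Z.
Proof. by move=> A0; rewrite frow_nat //; apply: mask_effective. Qed.

Definition Enorm A : nat := (\sum_i Erow A i)%N.

Lemma fnorm_Enorm A : effective A -> fnorm (fmask E A) = (Enorm A)%:Z.
Proof. by move=> A0; rewrite fnorm_row Posz_sum; apply: eq_bigr => i _; apply: frow_Erow. Qed.

Lemma vanishing_monomial A : REF L A ->
  \prod_k vanishing_var k ^+ mnm_of A k =
  (-1) ^+ Enorm A *: ('X_[mnm_of (fmask S A)] * \prod_i row_sum i ^+ Erow A i).
Proof.
move=> RA; rewrite (bigID (fun k => enum_val k \in E)) /= mulrC scalerAr; congr (_ * _).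
  rewrite mpolyXE_id big_mkcond; apply: eq_bigr => k _; rewrite !mnmE maskE in_setD /vanishing_var.
  case: (boolP (enum_val k \in E)) => //= kE; case: ifPn => // kD.
  by rewrite (REF_supp0 RA kD).
rewrite (partition_big (fun k => row_of (enum_val k)) predT) //=.
rewrite -mul_mpolyC /Enorm expr_sum rmorph_prod /= -big_split /=; apply: eq_bigr => i _.
rewrite rmorphXn rmorphN1 -exprNn /Erow.
rewrite [in RHS](reindex (@enum_val (cell d) predT)) /=; last first.
  by exists enum_rank => k _; [apply: enum_valK|apply: enum_rankK].
rewrite expr_sum big_mkcond [RHS]big_mkcond /=; apply: eq_bigr => k _.
rewrite /vanishing_var mnmE maskE; case: ifP => [kE|kE] /=.
  by case/andP: kE => -> /eqP ->; rewrite eqxx.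
by move: kE; case: (_ == i); rewrite ?andbT // => ->.
Qed.

Lemma coef_relation (G : 'X_{1..N}) :
  \sum_(A : bfilling d | REF L A) coef p A * ((-1) ^+ Enorm A *
    ('X_[mnm_of (fmask S A)] * \prod_i row_sum i ^+ Erow A i)@_G) = 0.
Proof.
have := congr1 (mcoeff G) res_vanishing.
rewrite {1}(res_expand d_gt0 pR) comp_mpoly_sumX (raddf_sum (mcoeff G)) mcoeff0 => H.
rewrite -[RHS]H; apply: eq_bigr => A RA; rewrite /= [in RHS]mcoeffZ.
congr (_ * _); rewrite -mcoeffZ -vanishing_monomial //; congr (_@_G).
by apply: eq_bigr => k _; rewrite tnth_mktuple.
Qed.

Variable A0 : filling d.
Hypothesis RA0 : REF L A0.

(** The monomial whose coefficient is extracted: that of A0 with each pure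
    coefficient replaced with the one of T in the same row, where the multinomial
    coefficient attached to A0 itself is 1. *)
Definition target : filling d := fmask S A0 + Pfill L (fmask E A0).

Lemma effectiveD A B : effective A -> effective B -> effective (A + B).
Proof. by move=> /forallP A1 /forallP B1; apply/forallP => c; rewrite ffunE addr_ge0. Qed.

Lemma target_effective : effective target.
Proof.
have A1 := REF_effective RA0.
by apply: effectiveD; [|apply: P_effective]; apply: mask_effective.
Qed.

Lemma target_supp c : target c != 0 -> c \in S.
Proof.
apply: contraR => cS; rewrite ffunE maskE (negPf cS) add0r ffunE.
by case: (boolP (c \in T)) => [/T_sub_S cS1|_]; [rewrite cS1 in cS|rewrite mulr0 eqxx].
Qed.

Lemma target_row (i : 'I_n) : (L <= i)%N -> frow target i = (delta d L i)%:Z.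
Proof.
move=> Li; rewrite frowD frow_P // -frow_split; first exact: REF_row.
by move=> c; apply: REF_supp0.
Qed.

Lemma frowB A B i : frow (A - B) i = frow A i - frow B i.
Proof. by rewrite frowD; congr (_ + _); rewrite /frow -sumrN; apply: eq_bigr => c _;
  rewrite ffunE. Qed.

Lemma target_diff A : target - fmask S A = fmask S (A0 - A) + Pfill L (fmask E A0).
Proof.
apply/ffunP => c; rewrite /target !ffunE; case: (c \in S); rewrite ?mul1r ?mul0r.
  by rewrite addrAC.
by rewrite !(add0r, subr0).
Qed.

(** The coefficient of the target monomial in the expansion of the resultant of
    forms vanishing at (0, .., 0, 1, .., 1). *)
Lemma Tcoef_mcoeff (A : filling d) : REF L A ->
  ratr (Tcoef L A0 A) = - (-1) ^+ Enorm A0 * ((-1) ^+ Enorm A *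
    ('X_[mnm_of (fmask S A)] * \prod_i row_sum i ^+ Erow A i)@_(mnm_of target)) :> C.
Proof.
move=> RA; have A1 := REF_effective RA; have A01 := REF_effective RA0.
rewrite mcoeff_mnmM /Tcoef -/target -target_diff.
have -> : fle (fmask S A) target = (mnm_of (fmask S A) <= mnm_of target)%MM.
  apply/forallP/mnm_lepP => [H k|H c].
    rewrite !mnmE -lez_nat !gez0_abs; [exact: H| |].
      by have /forallP := target_effective; apply.
    by have /forallP := mask_effective S A1; apply.
  have := H (enum_rank c); rewrite !mnm_ofE -lez_nat !gez0_abs //.
    by have /forallP := target_effective; apply.
  by have /forallP := mask_effective S A1; apply.
case: ifPn => [uG|_]; last by rewrite rmorph0 !mulr0.
rewrite !fnorm_Enorm // -!PoszD -exprnP rmorphM rmorphXn rmorphN1 /=.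
rewrite addn1 exprS exprD mulN1r !mulNr -!mulrA; congr (- (_ * (_ * _))).
pose D : filling d := target - fmask S A; have DE c : D c = target c - fmask S A c by rewrite
  !ffunE.
rewrite -/D.
set m := (mnm_of target - _)%MM.
(* The rows of the difference match the degrees of the row sums automatically, as
   both fillings have the rows prescribed by REF. *)
have mE c : m (enum_rank c) = `|D c|%N.
  rewrite mnmBE !mnm_ofE DE.
  have := mnm_lepP uG (enum_rank c); rewrite !mnm_ofE.
  have /forallP/(_ c) := target_effective; have /forallP/(_ c) := mask_effective S A1.
  case: (fmask S A c) => // u _; case: (target c) => // t _ /= ut.
  by rewrite subzn.
have m_fact : mfact m = (\prod_c `|D c|%N`!)%N.
  rewrite /mfact (reindex (@enum_rank (cell d))) /=.
    by apply: eq_bigr => c _; rewrite mE.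
  by exists enum_val => c _; [apply: enum_rankK|apply: enum_valK].
have mf0 : (mfact m)%:R != 0 :> C.
  by rewrite pnatr_eq0 -lt0n; apply: prodn_gt0 => k; apply: fact_gt0.
apply: (mulIf mf0); rewrite /bracket -m_fact fmorph_div /= !ratr_nat mulfVK // mulr_natr.
rewrite -[RHS]/((\prod_i row_sum i ^+ Erow A i)@_m *+ mfact m) (@mcoeff_prod_row_sums _ _ _ (fun
  k => row_of (enum_val k)) (fun k => enum_val k \in S) (Erow A) m).
- by congr _%:R; apply: eq_bigr => i _; rewrite frow_Erow.
- move=> k; rewrite -(enum_valK k) mE enum_rankK => mk; apply: contraNT mk => kS.
  rewrite DE maskE (negPf kS) subr0 absz_eq0.
  by apply: contraNT kS => /target_supp.
move=> i; rewrite (reindex (@enum_rank (cell d))) /=; last first.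
  by exists enum_val => c _; [apply: enum_rankK|apply: enum_valK].
rewrite (eq_bigl (fun c => row_of c == i)); last by move=> c; rewrite /= enum_rankK.
rewrite (eq_bigr (fun c => `|D c|%N)); last by move=> c _; apply: mE.
have diff_effective : effective D.
  apply/forallP => c; rewrite DE subr_ge0.
  have := mnm_lepP uG (enum_rank c); rewrite !mnm_ofE -lez_nat !gez0_abs //.
    by have /forallP := target_effective; apply.
  by have /forallP := mask_effective S A1; apply.
have [Li|iL] := leqP L i.
  apply/eqP; rewrite -eqz_nat -frow_nat // frowB target_row // -frow_Erow //.
  rewrite -(REF_row i RA) (@frow_split A i); first by rewrite addrAC subrr add0r.
  by move=> c; apply: REF_supp0 RA.
rewrite /Erow !big1 // => c /eqP ci.
  by rewrite maskE; case: ifP => // /E_sub_D/Dset_row; rewrite ci leqNgt iL.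
have cS : c \notin S by rewrite in_setD negb_and orbC; apply/orP; left;
  apply: contraL iL => /Dset_row; rewrite ci -leqNgt.
rewrite DE maskE (negPf cS) subr0; apply/eqP; rewrite absz_eq0.
by apply: contraNT cS => /target_supp.
Qed.

Lemma Tcoef_relation :
  \sum_(A : bfilling d | REF L A) ratr (Tcoef L A0 A) * coef p A = 0.
Proof.
have := coef_relation (mnm_of target) => /(congr1 (fun x => - (-1) ^+ Enorm A0 * x)).
rewrite mulr0 big_distrr /= => H; rewrite -[RHS]H; apply: eq_bigr => A RA.
by rewrite Tcoef_mcoeff // [X in _ = _ * X]mulrC -!mulrA.
Qed.

End Resultant.
End Relation.

(** * The relations are triangular *)

Section Order.
Variables (n : nat) (d : 'I_n -> nat).
Hypothesis d_gt0 : forall i, (0 < d i)%N.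
Local Notation N := #|{: cell d}|.
Implicit Types (A B : filling d) (c : cell d).
Variable L : 'I_n.
Hypothesis Ln : (L.+1 < n)%N.

Local Notation E := (Eset d L).
Local Notation T := (Tset d L).
Local Notation S := (Dset d L :\: E).

Lemma fillD A B c : (A + B : filling d) c = A c + B c.
Proof. by rewrite ffunE. Qed.

Lemma FRRP B : reflect (REF L B /\ B (pure_cell d L) = (delta d L L)%:Z) (FRR L B).
Proof.
apply: (iffP andP) => -[RB H]; split=> //.
  move/forallP/(_ (pure_cell d L)): H; rewrite row_mkcell expo_mkcell evecE !eqxx /=.
  by move/eqP.
apply/forallP => c; apply/implyP => /andP[/eqP/val_inj cL /eqP ce].
have -> : c = pure_cell d L by apply: cell_inj; rewrite ?cL // ce evecE cL.
by rewrite row_mkcell H.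
Qed.

Lemma REF_le_delta l B c : REF l B -> B c <= (delta d l (row_of c))%:Z.
Proof.
move=> RB; rewrite -(REF_row _ RB) /frow (bigD1 c) //= lerDl.
by apply: sumr_ge0 => c' _; apply: REF_ge0 RB.
Qed.

(** The filling P moves each row to one cell, which makes the bracket equal to 1. *)
Lemma Tcoef_diag A : REF L A -> Tcoef L A A = -1.
Proof.
move=> RA; have A1 := REF_effective RA; have mE1 := mask_effective E A1.
rewrite /Tcoef ifT; last first.
  apply/forallP => c; rewrite fillD lerDl.
  by have /forallP := P_effective L mE1; apply.
rewrite fnorm_Enorm // -!PoszD -exprnP addn1 exprS exprD -expr2 sqrr_sign.
rewrite mulr1 mulN1r; congr (- _); rewrite /bracket.
have -> : fmask S (A - A) + Pfill L (fmask E A) = Pfill L (fmask E A).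
  by apply/ffunP => c; rewrite subrr fillD maskE ffunE if_same add0r.
rewrite [X in _ / X%:R](partition_big (@row_of n d) predT) //=.
rewrite [X in X%:R / _](_ : _ = (\prod_(i < n) \prod_(c | row_of c == i)
  (`|Pfill L (fmask E A) c|)`!)%N); first last.
  apply: eq_bigr => i _; have [Li|iL] := leqP L i.
    rewrite (bigD1 (tcell d_gt0 L i)) //= ffunE row_mkcell TsetE Li eqxx mulr1 big1 ?muln1 //.
    by move=> c /andP[/eqP ci ct]; rewrite ffunE TsetE ci (negPf ct) andbF mulr0.
  have -> : frow (fmask E A) i = 0.
    rewrite /frow big1 // => c /eqP ci; rewrite maskE; case: ifP => // /E_sub_D/Dset_row.
    by rewrite ci leqNgt iL.
  rewrite big1 // => c /eqP ci; rewrite ffunE TsetE ci [(L <= i)%N]leqNgt iL.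
  by rewrite mulr0.
rewrite divff // pnatr_eq0 -lt0n; apply: prodn_gt0 => i; apply: prodn_gt0 => c.
exact: fact_gt0.
Qed.

Section Comparison.
Variables A A' : filling d.
Hypotheses (RA : REF L A) (RA' : REF L A').
Hypothesis same : forall c, c \in Dset d L :\: (E :|: T) -> A' c = A c.

Let D c : int := A' c - A c.
Let u (i : 'I_n) : int := D (tcell d_gt0 L i).

Lemma diff0 c : c \notin E -> c \notin T -> D c = 0.
Proof.
move=> cE cT; rewrite /D; have [cD|cD] := boolP (c \in Dset d L).
  by rewrite same ?subrr // in_setD in_setU negb_or cE cT.
by rewrite (REF_supp0 RA) // (REF_supp0 RA') // subrr.
Qed.

Lemma diff_row (f : cell d -> int) (i : 'I_n) : (L <= i)%N ->
  \sum_(c | row_of c == i) D c * f c =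
  D (pure_cell d i) * f (pure_cell d i) + u i * f (tcell d_gt0 L i).
Proof.
move=> Li; rewrite (bigD1 (pure_cell d i)) //=; congr (_ + _).
rewrite (bigD1 (tcell d_gt0 L i)) /=; last first.
  rewrite eqxx /=; apply: contraNneq (tmon_ne_pure d_gt0 Ln Li).
  by move/(congr1 (@expo n d)); rewrite !expo_mkcell => ->.
rewrite big1 ?addr0 // => c /andP[/andP[/eqP ci cp] ct].
rewrite diff0 ?mul0r //; first by rewrite EsetE is_pureP ci (negPf cp) andbF.
by rewrite (TsetE d_gt0) ci (negPf ct) andbF.
Qed.

Lemma diff_pure (i : 'I_n) : (L <= i)%N -> D (pure_cell d i) = - u i.
Proof.
move=> Li; apply/eqP; rewrite -subr_eq0 opprK; apply/eqP.
have := diff_row (fun=> 1) Li; rewrite !mulr1 => <-.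
rewrite (eq_bigr D) => [|c _]; last by rewrite mulr1.
by rewrite sumrB -!/(frow _ _) !(@REF_row _ _ L) // subrr.
Qed.

(** Moving u i units from the pure cell to the cell of T in each row i preserves the
    weights of REF. *)
Lemma diff_wt (j : 'I_n) : \sum_(i < n | (L <= i)%N)
  u i * ((tmon d L i j)%:Z - ((U_(i) *+ d i)%MM j)%:Z) = 0.
Proof.
transitivity (fwt A' j - fwt A j); last first.
  have [Lj|jL] := leqP L j; first by rewrite !(REF_wt _ Lj) // subrr.
  case/and4P: RA => _ _ _ /forallP/(_ j)/eqP ->.
  by case/and4P: RA' => _ _ _ /forallP/(_ j)/eqP ->; rewrite subrr.
rewrite /fwt -sumrB (partition_big (@row_of n d) predT) //= big_mkcond.
apply: eq_bigr => i _; rewrite (eq_bigr (fun c => D c * (expo c j)%:Z)); last first.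
  by move=> c _; rewrite -mulrBl.
case: leqP => [Li|iL].
  by rewrite diff_row // diff_pure // !expo_mkcell mulrBr mulNr addrC.
rewrite big1 // => c /eqP ci; rewrite diff0 ?mul0r //.
  by rewrite EsetE ci leqNgt iL.
by rewrite (TsetE d_gt0) ci leqNgt iL.
Qed.

(** The variable x_j with j = i + 1 > L only occurs in the cell of T of row i, with
    exponent 1, and in the pure cell of row j, with exponent d j. *)
Lemma diff_step (i j : 'I_n) : (L <= i)%N -> j = i.+1 :> nat -> u i = (d j)%:Z * u j.
Proof.
move=> Li ji; have Lj : (L <= j)%N by rewrite ji leqW.
have ij : i != j by rewrite -val_eqE /= ji neq_ltn leqnn.
have jL : (j == L :> nat) = false by apply/negbTE; rewrite ji neq_ltn ltnS Li orbT.
have := diff_wt j; rewrite (bigD1 i) //= (bigD1 j) /=; last by rewrite Lj eq_sym ij.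
rewrite big1 ?addr0 => [|k /andP[/andP[Lk ki] kj]].
  rewrite /tmon -ji ltn_ord !mnmDE !mulmnE !mnm1E !evecnE eqxx (negPf ij) jL !mul0n add0n subr0.
  rewrite mulr1 eqxx mul1n => H; apply/eqP; rewrite -subr_eq0 -{}[0]H; apply/eqP.
  rewrite -[in LHS](mulrC (u j)); congr (_ + _).
  case: ifP => j1; rewrite ?mnmDE mulmnE !evecnE jL mul0n.
    by rewrite add0n (ltn_eqF (ltnSn j)) sub0r mulrN.
  by rewrite sub0r mulrN.
rewrite mulmnE mnm1E (negPf kj) mul0n subr0 /tmon.
case: ifP => k1; rewrite ?mnmDE mulmnE !evecnE jL mul0n ?mulr0 // add0n.
case: eqP => [jk|]; last by rewrite mulr0.
by case/eqP: ki; apply: val_inj; apply: succn_inj; rewrite -jk ji.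
Qed.

Lemma diff_last : exists v : int, forall i : 'I_n, (L <= i)%N ->
  u i = (\prod_(j < n | (i < j)%N) d j)%N%:Z * v.
Proof.
have n1 : (n.-1 < n)%N by rewrite prednK // (leq_trans _ Ln).
exists (u (Ordinal n1)) => i.
have [k] : exists k, (n.-1 - i)%N = k by exists (n.-1 - i)%N.
elim: k i => [|k IH] i ik Li.
  have -> : i = Ordinal n1 by apply: val_inj => /=; have := ltn_ord i; lia.
  rewrite big_pred0 ?mul1r // => j /=; have := ltn_ord j; lia.
have i1 : (i.+1 < n)%N by lia.
rewrite (@diff_step i (Ordinal i1)) // (IH (Ordinal i1)) /=; [|by lia|by lia].
rewrite mulrA -PoszM; congr (Posz _ * _).
rewrite [RHS](bigD1 (Ordinal i1)) //=; congr muln; apply: eq_bigl => j.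
by rewrite -val_eqE /=; lia.
Qed.

(** By the previous recursion, the row L changes by a multiple of delta L, which is
    the total of that row; unless the multiple is 0, the pure cell of row L is full
    in A or in A'. *)
Lemma comparison : A' = A \/ FRR L A \/ FRR L A'.
Proof.
have [v uv] := diff_last.
have uL : u L = (delta d L L)%:Z * v.
  rewrite uv //; congr (Posz _ * _); rewrite /delta leqnn; apply: eq_bigl => j.
  by rewrite ltn_neqAle eq_sym val_eqE andbC.
have DL := diff_pure (leqnn L); rewrite uL /D in DL.
have le c B := @REF_le_delta L B c; have ge c B := @REF_ge0 _ _ L B c.
have := le (pure_cell d L) _ RA; have := le (pure_cell d L) _ RA'.
have := ge (pure_cell d L) _ RA; have := ge (pure_cell d L) _ RA'.
rewrite !row_mkcell => a'0 a0 a'd ad.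
have [v_lt|v_gt|v0] := ltrgtP v 0.
- right; right; apply/FRRP; split=> //; move: DL a'd a0 v_lt; nia.
- right; left; apply/FRRP; split=> //; move: DL ad a'0 v_gt; nia.
left; apply/ffunP => c; apply/eqP; rewrite -subr_eq0 -/(D c).
have u0 (i : 'I_n) : (L <= i)%N -> u i = 0 by move=> Li; rewrite uv // v0 mulr0.
have [cE|cE] := boolP (c \in E).
  have := cE; rewrite EsetE => /andP[Lc _]; by rewrite (Eset_cell cE) diff_pure // u0.
have [cT|cT] := boolP (c \in T); last by rewrite diff0.
by move: cT; rewrite (TsetE d_gt0) => /andP[Lc /eqP ->]; rewrite -/(u _) u0.
Qed.

End Comparison.

(** The indicator in T forces A' <= A outside the cells of E and T, with equality
    only in the situation of [comparison]. *)
Lemma Tcoef_prec A A' : REF L A -> ~~ FRR L A -> REF L A' ->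
  Tcoef L A A' != 0 -> A' <> A -> prec L A' A.
Proof.
move=> RA nFA RA' TA AA'; rewrite /prec nFA andbT.
have [//|nFA'] := boolP (FRR L A').
have A'_le c : c \in Dset d L :\: (E :|: T) -> A' c <= A c.
  rewrite in_setD in_setU negb_or => /andP[/andP[cE cT] cD].
  move: TA; rewrite /Tcoef; case: ifP => [/forallP/(_ c) + _|]; last by rewrite eqxx.
  by rewrite fillD [X in _ + X]ffunE !maskE in_setD cE cD (negPf cT) mulr0 addr0.
have mask_le c : fmask (Dset d L :\: (E :|: T)) A' c <= fmask (Dset d L :\: (E :|: T)) A c.
  by rewrite !maskE; case: ifP => // /A'_le.
rewrite lt_neqAle ler_sum /=; last by move=> c _; apply: mask_le.
rewrite andbT; apply/negP => /eqP Zeq.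
case: (@comparison A A' RA RA') => [c cD|//|[FA|FA']]; last 2 first.
- by rewrite FA in nFA.
- by rewrite FA' in nFA'.
apply/eqP; have : \sum_c (fmask (Dset d L :\: (E :|: T)) A c - fmask (Dset d L :\: (E :|: T)) A'
  c) == 0.
  by rewrite sumrB -!/(fnorm _) -!/(Zdeg _ _) Zeq subrr.
rewrite psumr_eq0 => [/allP/(_ c (mem_index_enum c))|c' _]; last by rewrite subr_ge0.
by rewrite /= !maskE cD subr_eq0 eq_sym.
Qed.

End Order.

(** * Unrolling the relations along chains *)

Lemma sum_cons_tuple (V : nmodType) (X : finType) k (P : pred X) (F : seq X -> V) :
  \sum_(s : k.+1.-tuple X | all P s) F s =
  \sum_(x | P x) \sum_(s : k.-tuple X | all P s) F (x :: s).
Proof.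
rewrite pair_big_dep /=.
rewrite (reindex (fun q : X * k.-tuple X => [tuple of q.1 :: q.2])) /=.
  by apply: eq_big.
exists (fun s : k.+1.-tuple X => (thead s, [tuple of behead s])) => [[x s]|s] _ /=.
  by congr (_, _); apply: val_inj.
by rewrite [s in RHS]tuple_eta.
Qed.

Section Chains.
Variables (n : nat) (d : 'I_n -> nat).
Hypothesis d_gt0 : forall i, (0 < d i)%N.
Local Notation N := #|{: cell d}|.
Local Notation bf := (bfilling d).
Variable L : 'I_n.
Hypothesis Ln : (L.+1 < n)%N.
Implicit Types (A B : filling d).

Local Notation nonFRR := (fun X : bf => REF L X && ~~ FRR L X).
Local Notation descends := (fun X Y : filling d => prec L Y X).

(** The k-th term of the sum defining C, in a form that can be unfolded one element
    of the chain at a time. *)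
Definition chain_sum k A B : rat :=
  \sum_(s : k.-tuple bf | all nonFRR s)
    if path descends A (rcons (map (@fil n d) s) B)
    then \prod_(x <- pairmap (Tcoef L) A (rcons (map (@fil n d) s) B)) x else 0.

Lemma chain_sum0 A B : chain_sum 0 A B = if prec L B A then Tcoef L A B else 0.
Proof.
rewrite /chain_sum (big_pred1 [tuple]) => [|s]; last by rewrite tuple0; apply/esym/eqP.
by rewrite /= andbT big_cons big_nil mulr1.
Qed.

Lemma chain_sumS k A B : chain_sum k.+1 A B =
  \sum_(X : bf | nonFRR X && prec L X A) Tcoef L A X * chain_sum k X B.
Proof.
pose F (s : seq bf) := if path descends A (rcons (map (@fil n d) s) B)
    then \prod_(x <- pairmap (Tcoef L) A (rcons (map (@fil n d) s) B)) x else 0.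
rewrite /chain_sum -[LHS]/(\sum_(s : k.+1.-tuple bf | all nonFRR s) F s) sum_cons_tuple.
rewrite [RHS]big_mkcondr; apply: eq_bigr => X _; rewrite /F /=.
case: (prec L (fil X) A) => /=; last by rewrite big1.
rewrite big_distrr; apply: eq_bigr => s _ /=.
by case: ifP; rewrite ?mulr0 // big_cons.
Qed.

Lemma CcoefE A B : ~~ FRR L A ->
  Ccoef L A B = \sum_(k < #|{: bf}|.+1) chain_sum k A B.
Proof. by move=> nFA; rewrite /Ccoef (negPf nFA). Qed.

Section Resultant.
Variables (C : numClosedFieldType) (p : {mpoly C[N]}).
Hypothesis pR : is_res L p.
Local Notation r := (coef p).

Lemma coef_prec (A : bf) : REF L A -> ~~ FRR L A ->
  r A = \sum_(X : bf | REF L X && prec L X A) ratr (Tcoef L A X) * r X.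
Proof.
move=> RA nFA; have := Tcoef_relation d_gt0 Ln pR RA.
rewrite (bigD1 A) //= (Tcoef_diag d_gt0 RA) rmorphN1 mulN1r => /eqP.
rewrite addrC subr_eq0 => /eqP <-; rewrite [LHS]big_mkcondr [RHS]big_mkcondr;
  apply: eq_bigr => X RX.
have [->|XA] := eqVneq X A; first by rewrite /prec (negPf nFA) ltxx.
case: (boolP (prec L (fil X) A)) => // npX; apply/eqP; rewrite mulf_eq0; apply/orP; left.
rewrite fmorph_eq0; apply: contraR npX => TX; apply: (Tcoef_prec d_gt0 Ln) => //.
by move/fil_inj/eqP; apply/negP.
Qed.

(** What is left of the coefficient of A after k substitutions of the relations. *)
Fixpoint remainder k A : C :=
  if k is k'.+1 then \sum_(X : bf | nonFRR X && prec L X A) ratr (Tcoef L A X) * remainder k' X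
  else r A.

Lemma coef_unroll k (A : bf) : REF L A -> ~~ FRR L A ->
  r A = \sum_(B : bf | FRR L B) ratr (\sum_(j < k) chain_sum j A B) * r B + remainder k A.
Proof.
elim: k A => [|k IH] A RA nFA.
  by rewrite big1 ?add0r // => B _; rewrite big_ord0 rmorph0 mul0r.
rewrite [LHS]coef_prec // (bigID (fun X : bf => FRR L X)) /=.
have -> : \sum_(X : bf | REF L X && prec L X A && FRR L X) ratr (Tcoef L A X) * r X =
    \sum_(B : bf | FRR L B) ratr (chain_sum 0 A B) * r B.
  rewrite big_mkcond [RHS]big_mkcond; apply: eq_bigr => B _; rewrite chain_sum0 /prec (negPf nFA).
  case FB: (FRR L (fil B)); last by rewrite andbF.
  by case/andP: (FB) => -> _.
rewrite [X in _ + X](eq_bigl (fun X : bf => nonFRR X && prec L X A)); last by move=> X;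
  rewrite andbAC.
rewrite [X in _ + X](eq_bigr (fun X : bf => ratr (Tcoef L A X) *
    (\sum_(B : bf | FRR L B) ratr (\sum_(j < k) chain_sum j X B) * r B) +
    ratr (Tcoef L A X) * remainder k X)); last first.
  by move=> X /andP[/andP[RX nFX] _]; rewrite -mulrDr; congr (_ * _); apply: IH.
rewrite big_split /= addrA; congr (_ + _).
rewrite [X in _ + X](eq_bigr (fun X : bf => \sum_(B : bf | FRR L B)
    ratr (Tcoef L A X * \sum_(j < k) chain_sum j X B) * r B)); last first.
  by move=> X _; rewrite big_distrr; apply: eq_bigr => B _; rewrite /= rmorphM mulrA.
rewrite [X in _ + X]exchange_big -big_split; apply: eq_bigr => B _ /=.
rewrite -big_distrl -mulrDl /= -rmorph_sum -rmorphD /= big_ord_recl; congr (ratr (_ + _) * _).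
rewrite (eq_bigr (fun X : bf => \sum_(j < k) Tcoef L A X * chain_sum j X (fil B))); last first.
  by move=> X _; rewrite big_distrr.
by rewrite exchange_big; apply: eq_bigr => j _; rewrite chain_sumS.
Qed.

Lemma remainder_chain k A : remainder k A != 0 -> exists s : seq bf,
  [/\ size s = k, all (fun X : bf => ~~ FRR L X) s & path descends A (map (@fil n d) s)].
Proof.
elim: k A => [|k IH] A /=; first by exists [::].
move=> H; have [X /andP[/andP[RX nFX] pX] rX] : exists2 X : bf,
    nonFRR X && prec L X A & remainder k X != 0.
  apply: contrapT => nX; case/eqP: H; apply: big1 => X HX.
  have [->|rX] := eqVneq (remainder k (fil X)) 0; first by rewrite mulr0.
  by case: nX; exists X.
have [s [sk ns ps]] := IH X rX; exists (X :: s); split=> /=.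
- by rewrite sk.
- by rewrite nFX.
by rewrite pX.
Qed.

(** Chains are strictly decreasing, so the remainder is eventually 0. *)
Lemma coef_Ccoef (A : bf) : REF L A ->
  r A = \sum_(B : bf | FRR L B) ratr (Ccoef L A B) * r B.
Proof.
move=> RA; have [FA|nFA] := boolP (FRR L A).
  rewrite (bigD1 A) //= /Ccoef FA eqxx rmorph1 mul1r big1 ?addr0 // => B /andP[_ BA].
  case: eqP => [/fil_inj AB|]; last by rewrite rmorph0 mul0r.
  by rewrite AB eqxx in BA.
rewrite [LHS](@coef_unroll #|{: bf}|.+1) //.
have -> : remainder #|{: bf}|.+1 A = 0.
  apply/eqP/negPn/negP => /remainder_chain[s [ss ns ps]].
  by have := chain_size nFA ns ps; rewrite ss ltnn.
by rewrite addr0; apply: eq_bigr => B _; rewrite CcoefE.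
Qed.

End Resultant.
End Chains.

(** * Fillings with a reduced row *)

Section Reduction.
Variables (n : nat) (d : 'I_n -> nat).
Hypothesis d_gt0 : forall i, (0 < d i)%N.
Local Notation N := #|{: cell d}|.
Local Notation bf := (bfilling d).
Variable L : 'I_n.
Hypothesis Ln : (L.+1 < n)%N.
Implicit Types (A B : filling d) (c : cell d).
Local Notation D' := (Dset d L.+1).

Lemma FRR_row B c : FRR L B -> row_of c = L -> c != pure_cell d L -> B c = 0.
Proof.
case/FRRP => RB BL cL cp; have /eqP := REF_row L RB.
rewrite /frow (bigD1 (pure_cell d L)) //= BL -subr_eq0 addrAC subrr add0r.
rewrite psumr_eq0 => [|c' _]; last exact: REF_ge0 RB.
by move/allP/(_ c (mem_index_enum c)); rewrite cL cp eqxx => /eqP.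
Qed.

(** The full pure cell of row L exhausts the weight in x_L. *)
Lemma FRR_supp B c : FRR L B -> row_of c != L -> c \notin D' -> B c = 0.
Proof.
move=> FB cL cD'; case/FRRP: (FB) => RB BL; apply/eqP; apply: contraR cD' => Bc.
have cD := REF_supp RB Bc.
apply/DsetP; split=> [|j]; first by rewrite ltn_neqAle eq_sym val_eqE cL (Dset_row cD).
rewrite ltnS leq_eqVlt => /orP[/eqP/val_inj ->|]; last exact: Dset_expo cD.
have /eqP := REF_wt RB (leqnn L); rewrite -(@delta_mul n d L L) //.
rewrite /fwt (bigD1 (pure_cell d L)) //= BL expo_mkcell mulmnE mnm1E eqxx mul1n.
rewrite -PoszM mulnC -subr_eq0 addrAC subrr add0r psumr_eq0 => [|c' _]; last first.
  by rewrite mulr_ge0 // (REF_ge0 _ RB).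
move/allP/(_ c (mem_index_enum c)); have -> : c != pure_cell d L.
  by apply: contraNneq cL => ->.
by rewrite /= mulf_eq0 (negPf Bc) => /eqP[].
Qed.

(** A filling of FRR is known in row L, and the rest lies in the next level. *)
Lemma mask_FRR_inj B B' : FRR L B -> FRR L B' -> fmask D' B = fmask D' B' -> B = B'.
Proof.
move=> FB FB' /ffunP BB'; apply/ffunP => c.
have [cL|cL] := eqVneq (row_of c) L.
  have [->|cp] := eqVneq c (pure_cell d L); last by rewrite !FRR_row.
  by case/FRRP: FB => _ ->; case/FRRP: FB' => _ ->.
have := BB' c; rewrite !maskE; case: ifP => // /negbT cD' _.
by rewrite !FRR_supp.
Qed.

Section Resultant.
Variables (C : numClosedFieldType) (p p' : {mpoly C[N]}).
Hypotheses (pR : is_res L p) (pR' : is_res L.+1 p').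
Hypothesis p_reduce : forall a, p.@[point (pure_row L a)] = p'.@[point a] ^+ d L.
Local Notation r := (coef p).
Local Notation r' := (coef p').

(** Substituting the pure power in row L kills the monomials outside FRR. *)
Lemma reduced_expansion :
  \sum_(B : bf | FRR L B) r B *: 'X_[mnm_of (fmask D' B)] = p' ^+ d L.
Proof.
apply: mpoly_eq_fun => v; rewrite rmorphXn raddf_sum /=.
pose a c := v (enum_rank c).
have -> : p'.@[v] = p'.@[point a] by apply: meval_eq => k; rewrite /point /a enum_valK.
rewrite -p_reduce (meval_res d_gt0 _ pR) [RHS](bigID (fun B : bf => FRR L B)) /=.
rewrite [X in _ = _ + X]big1 ?addr0; last first.
  move=> A /andP[RA nFA]. apply/eqP; rewrite mulf_eq0; apply/orP; right.
  have [c /andP[/eqP cL cp] Ac] : exists2 c, (row_of c == L) && (c != pure_cell d L) & fil A c != 0.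
    apply: contrapT => nX; case/negP: nFA; apply/FRRP; split=> //.
    rewrite -(REF_row L RA) /frow (bigD1 (pure_cell d L)) //= big1 ?addr0 // => c Hc.
    by apply/eqP/negPn/negP => Ac; apply: nX; exists c.
  rewrite (bigD1 c) //= mulf_eq0 /point enum_rankK /pure_row cL eqxx /pure is_pureP cL.
  by rewrite (negPf cp) expr0n absz_eq0 (negPf Ac) eqxx.
rewrite [RHS](eq_bigl (fun B : bf => FRR L B)); last first.
  by move=> B; rewrite andb_idl // => /FRRP[].
apply: eq_bigr => B FB; rewrite mevalZ meval_mnm_of; congr (_ * _).
apply: eq_bigr => c _; rewrite /point enum_rankK /pure_row maskE /a.
case: eqP => [cL|/eqP cL].
  have -> : c \in D' = false by apply/negP => /Dset_row; rewrite cL ltnn.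
  rewrite expr0 /pure is_pureP cL; case: eqP => [_|/eqP cp]; first by rewrite expr1n.
  by rewrite FRR_row.
by case: ifPn => // cD'; rewrite FRR_supp.
Qed.

Lemma sum_effective (I : finType) (F : I -> filling d) :
  (forall i, effective (F i)) -> effective (\sum_i F i).
Proof.
move=> F1; apply/forallP => c; rewrite sum_ffunE; apply: sumr_ge0 => i _.
by have /forallP := F1 i; apply.
Qed.

Lemma mnm_of_sum (I : finType) (F : I -> filling d) : (forall i, effective (F i)) ->
  mnm_of (\sum_i F i) = (\sum_i mnm_of (F i))%MM.
Proof.
move=> F1; apply/mnmP => k; rewrite mnm_sumE mnmE sum_ffunE.
apply/eqP; rewrite -eqz_nat Posz_sum gez0_abs.
  apply/eqP/eq_bigr => i _; rewrite mnmE gez0_abs //.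
  by have /forallP := F1 i; apply.
by apply: sumr_ge0 => i _; have /forallP := F1 i; apply.
Qed.

Lemma mnm_of_eq A B : effective A -> effective B -> (mnm_of A == mnm_of B) = (A == B).
Proof.
move=> A1 B1; apply/eqP/eqP => [|->//] AB.
by rewrite -(mnm_ofK A1) AB mnm_ofK.
Qed.

(** Expand the d-th power and compare the coefficients of one monomial. *)
Lemma coef_FRR (B : bf) : FRR L B ->
  r B = \sum_(Bs : {ffun 'I_(d L) -> bf} | Bs \in ffun_on (fun X : bf => REF L.+1 X))
    if \sum_j fil (Bs j) == fmask D' B then \prod_j r' (Bs j) else 0.
Proof.
move=> FB; have := congr1 (mcoeff (mnm_of (fmask D' B))) reduced_expansion.
rewrite raddf_sum /= (bigD1 B) //= mcoeffZ mcoeffX eqxx mulr1 big1 => [|X /andP[FX XB]]; last first.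
  rewrite mcoeffZ mcoeffX mnm_of_eq ?mask_effective ?fil_effective //.
  case: eqP => [/(mask_FRR_inj FX FB)/fil_inj XB'|]; last by rewrite mulr0.
  by rewrite XB' eqxx in XB.
rewrite addr0 => ->; rewrite {1}(res_expand d_gt0 pR') -[in LHS](card_ord (d L)) -prodr_const.
rewrite bigA_distr_big raddf_sum /=; apply: eq_bigr => Bs _.
rewrite scaler_prod mprodXE mcoeffZ mcoeffX -mnm_of_sum => [|j]; last exact: fil_effective.
rewrite mnm_of_eq ?mask_effective ?fil_effective //; last first.
  by apply: sum_effective => j; apply: fil_effective.
by case: eqP; rewrite ?mulr1 ?mulr0.
Qed.

Lemma coef_Wcoef (A : bf) : REF L A ->
  r A = \sum_(Bs : {ffun 'I_(d L) -> bf} | Bs \in ffun_on (fun X : bf => REF L.+1 X))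
    ratr (Wcoef A (fun j => fil (Bs j))) * \prod_j r' (Bs j).
Proof.
move=> RA; rewrite (coef_Ccoef d_gt0 Ln pR RA).
rewrite (eq_bigr (fun B : bf => \sum_(Bs : {ffun 'I_(d L) -> bf} | Bs \in ffun_on (fun X : bf =>
  REF L.+1 X))
    ratr (if \sum_j fil (Bs j) == fmask D' B then Ccoef L A B else 0) * \prod_j r' (Bs j))).
  rewrite exchange_big; apply: eq_bigr => Bs _ /=.
  by rewrite -big_distrl /= -rmorph_sum.
move=> B FB; rewrite coef_FRR // big_distrr; apply: eq_bigr => Bs _ /=.
by case: ifP; rewrite ?rmorph0 ?mulr0 ?mul0r.
Qed.

End Resultant.
End Reduction.

(** * Collections indexed by words *)

Section Trees.
Variables (n : nat) (d : 'I_n -> nat).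
Hypothesis d_gt0 : forall i, (0 < d i)%N.
Local Notation N := #|{: cell d}|.
Local Notation bf := (bfilling d).
Local Notation node := (seq_sub (nodes d)).
Implicit Types (A B : filling d) (Bc : collection d) (w : seq nat).

Lemma mem_nodes w : (w \in nodes d) =
  (size w < n)%N && [forall i : 'I_n, (i < size w)%N ==> (nth 0%N w i < d i)%N].
Proof.
apply/flatten_mapP/andP => [[l]|[wn wd]].
  rewrite mem_iota add0n => /andP[_ ln]; rewrite mem_words ?(ltnW ln) // => /andP[/eqP -> wd].
  by rewrite ln.
by exists (size w); [rewrite mem_iota|rewrite mem_words ?(ltnW wn) // eqxx].
Qed.

Lemma mem_words_nodes l w : (l < n)%N -> (w \in words d l) = (w \in nodes d) && (size w == l).
Proof.
move=> ln; rewrite mem_nodes mem_words ?(ltnW ln) // andbC.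
by case: eqP => [->|]; rewrite ?andbF // ln !andbT.
Qed.

Lemma words_rcons (l : 'I_n) :
  words d l.+1 = [seq rcons w j | w <- words d l, j <- iota 0 (d l)].
Proof.
rewrite /words (take_nth l) ?size_enum_ord // -cats1 foldl_cat /=.
suff -> : nth l (enum 'I_n) l = l by [].
by apply: val_inj; rewrite /= nth_enum_ord.
Qed.

Definition zero_bfilling : bf := [ffun=> ord0].

Lemma fil_zero : fil zero_bfilling = 0.
Proof. by apply/ffunP => c; rewrite !ffunE. Qed.

Definition node_filling Bc w : bf := if insub w is Some u then Bc u else zero_bfilling.

Lemma lookupE Bc w : lookup Bc w = fil (node_filling Bc w).
Proof. by rewrite /lookup /node_filling; case: insub => //; rewrite fil_zero. Qed.

Lemma node_filling_val Bc (u : node) : node_filling Bc (val u) = Bc u.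
Proof. by rewrite /node_filling valK. Qed.

Lemma prod_words (R : comNzRingType) l (F : seq nat -> R) : (l < n)%N ->
  \prod_(w <- words d l) F w = \prod_(u : node | size (val u) == l) F (val u).
Proof.
move=> ln; rewrite -[RHS]big_filter -[RHS](big_map val xpredT F); apply: perm_big.
apply: uniq_perm; first exact: words_uniq.
  by rewrite map_inj_uniq ?filter_uniq ?index_enum_uniq //; apply: val_inj.
move=> w; rewrite mem_words_nodes //; apply/andP/mapP => [[wN wl]|[u]].
  by exists (SeqSub wN); rewrite ?mem_filter ?mem_index_enum //= wl.
by rewrite mem_filter => /andP[ul _] ->; split=> //; apply: (valP u).
Qed.

(** Collections of fillings for the words of length at most m, extended by zero so
    as to keep the type of the index set fixed while m varies. *)
Definition level_ok m Bc : bool :=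
  [forall u : node,
     if (size (val u) <= m)%N then REF (size (val u)) (Bc u) else Bc u == zero_bfilling].

Lemma level_okP m Bc (u : node) : level_ok m Bc -> (size (val u) <= m)%N ->
  REF (size (val u)) (Bc u).
Proof. by move=> /forallP/(_ u) + um; rewrite um. Qed.

Definition Wprod m Bc : rat := \prod_(l < n | (l < m)%N) \prod_(w <- words d l)
  Wcoef (lookup Bc w) (fun j : 'I_(d l) => lookup Bc (rcons w j)).

Section Step.
Variable L : 'I_n.
Hypothesis Ln : (L.+1 < n)%N.
Local Notation bfs := {ffun 'I_(d L) -> bf}.
Let zero_children : bfs := [ffun=> zero_bfilling].
Let j0 : 'I_(d L) := Ordinal (d_gt0 L).

Definition cut Bc : collection d :=
  [ffun u : node => if (size (val u) <= L)%N then Bc u else zero_bfilling].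

Definition children Bc : {ffun node -> bfs} :=
  [ffun u : node =>
     if size (val u) == L then [ffun j : 'I_(d L) => node_filling Bc (rcons (val u) j)] else
       zero_children].

Definition node_children (f : {ffun node -> bfs}) w : bfs :=
  if insub w is Some u then f u else zero_children.

(** The converse of [cut] and [children]: a word of length L + 1 is a word of length
    L followed by a letter. *)
Definition graft Bc (f : {ffun node -> bfs}) : collection d :=
  [ffun u : node => if (size (val u) <= L)%N then Bc u else
    if size (val u) == L.+1 then node_children f (take L (val u)) (insubd j0 (nth 0%N (val u) L))
    else zero_bfilling].

Lemma nodes_rcons (u : node) (j : 'I_(d L)) : size (val u) = L -> rcons (val u) j \in nodes d.
Proof.
move=> uL; rewrite mem_nodes size_rcons uL Ln; apply/forallP => i; apply/implyP.
rewrite nth_rcons uL ltnS leq_eqVlt => /orP[/eqP/val_inj ->|iL]; first by rewrite ltnn eqxx.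
have := valP u; rewrite mem_nodes => /andP[_ /forallP/(_ i)/implyP]; rewrite iL.
by apply; rewrite uL.
Qed.

Lemma nodes_take (u : node) : size (val u) = L.+1 -> take L (val u) \in nodes d.
Proof.
move=> uL; have := valP u; rewrite !mem_nodes => /andP[_ /forallP ud].
rewrite size_take uL leqnn ltn_ord; apply/forallP => i; apply/implyP => iL.
by rewrite nth_take //; apply: (implyP (ud i)); rewrite uL ltnW.
Qed.

Lemma nodes_last (u : node) : size (val u) = L.+1 -> (nth 0%N (val u) L < d L)%N.
Proof.
move=> uL; have := valP u; rewrite mem_nodes => /andP[_ /forallP/(_ L)/implyP]; apply.
by rewrite uL.
Qed.

Lemma take_rcons_last (u : node) : size (val u) = L.+1 ->
  rcons (take L (val u)) (nth 0%N (val u) L) = val u.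
Proof. by move=> uL; rewrite -take_nth ?uL // -uL take_size. Qed.

Lemma graft_cut Bc : level_ok L.+1 Bc -> graft (cut Bc) (children Bc) = Bc.
Proof.
move=> ok; apply/ffunP => u; rewrite ffunE; case: leqP => [uL|Lu]; first by rewrite ffunE uL.
case: eqP => [uL|/eqP uL].
  have tN := nodes_take uL.
  rewrite /node_children (insubT (fun w => w \in nodes d) tN) ffunE /= size_take uL leqnn eqxx
    ffunE.
  by rewrite -[nat_of_ord _]/(val _) val_insubd (nodes_last uL) take_rcons_last // node_filling_val.
have /forallP/(_ u) := ok; rewrite leqNgt ltn_neqAle eq_sym uL Lu /=.
by move/eqP.
Qed.

Lemma cut_graft Bc (f : {ffun node -> bfs}) : level_ok L Bc -> cut (graft Bc f) = Bc.
Proof.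
move=> ok; apply/ffunP => u; rewrite !ffunE; have /forallP/(_ u) := ok.
by case: leqP => // _ /eqP.
Qed.

Lemma children_graft Bc (f : {ffun node -> bfs}) :
  (forall u, size (val u) != L -> f u = zero_children) ->
  children (graft Bc f) = f.
Proof.
move=> f0; apply/ffunP => u; rewrite ffunE; case: eqP => [uL|/eqP uL]; last by rewrite f0.
apply/ffunP => j; rewrite ffunE; have rN := nodes_rcons j uL.
rewrite /node_filling (insubT (fun w => w \in nodes d) rN) ffunE /= size_rcons uL ltnn eqxx.
rewrite -cats1 take_size_cat // cats1 nth_rcons uL ltnn eqxx /node_children valK.
by congr (f u _); apply: val_inj; rewrite val_insubd ltn_ord.
Qed.

(** This is the bijection between the collections of depth L + 1 and the pairs of a
    collection of depth L and a family of children for its last words. *)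
Lemma level_ok_children Bc : level_ok L.+1 Bc =
  [&& level_ok L (cut Bc),
      children Bc \in pfamily zero_children (fun u => size (val u) == L)
        (fun=> ffun_on (fun X : bf => REF L.+1 X)) &
      graft (cut Bc) (children Bc) == Bc].
Proof.
apply/idP/and3P => [ok|[ok /pfamilyP[_ chR] /eqP gr]].
  split; last by rewrite graft_cut.
    apply/forallP => u; rewrite ffunE; case: leqP => // uL.
    by apply: (level_okP ok); apply: leqW.
  apply/pfamilyP; split=> [|u uL].
    by apply/subsetP => u; rewrite !inE ffunE; case: ifP => //; rewrite eqxx.
  rewrite unfold_in /= in uL; apply/ffun_onP => j; rewrite ffunE uL ffunE.
  have rN := nodes_rcons j (eqP uL); rewrite /node_filling (insubT (fun w => w \in nodes d) rN).
  have := @level_okP L.+1 Bc (SeqSub rN) ok; rewrite /= size_rcons (eqP uL) leqnn.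
  exact.
apply/forallP => u; case: ltngtP => [uL|uL|uL].
- by rewrite -gr ffunE -ltnS uL; apply: (level_okP ok).
- by rewrite -gr ffunE leqNgt (ltnW uL) /= gtn_eqF.
rewrite -gr ffunE uL ltnn eqxx /node_children (insubT (fun w => w \in nodes d) (nodes_take uL)).
have tL : size (val (SeqSub (nodes_take uL) : node)) == L.
  by rewrite /= size_take uL leqnn.
by have /ffun_onP := chR _ tL; apply.
Qed.

Lemma node_filling_cut Bc w : (size w <= L)%N -> node_filling (cut Bc) w = node_filling Bc w.
Proof. by move=> wL; rewrite /node_filling; case: insubP => // u _ uw; rewrite ffunE uw wL. Qed.

Lemma lookup_cut Bc w : (size w <= L)%N -> lookup (cut Bc) w = lookup Bc w.
Proof. by move=> wL; rewrite !lookupE node_filling_cut. Qed.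

Lemma Wprod_cut Bc : Wprod L (cut Bc) = Wprod L Bc.
Proof.
apply: eq_bigr => l lL; rewrite big_seq [RHS]big_seq; apply: eq_bigr => w.
rewrite mem_words ?(ltnW (ltn_ord l)) // => /andP[/eqP wl _]; rewrite lookup_cut ?wl ?(ltnW lL) //.
congr Wcoef; apply: funext => j; rewrite lookup_cut // size_rcons wl //.
Qed.

Lemma WprodS Bc : Wprod L.+1 Bc = Wprod L Bc * \prod_(w <- words d L)
  Wcoef (lookup Bc w) (fun j : 'I_(d L) => lookup Bc (rcons w j)).
Proof.
rewrite /Wprod (bigD1 L) //= mulrC; congr (_ * _); apply: eq_bigl => l.
by rewrite ltnS andbC -val_eqE /= -ltn_neqAle.
Qed.

End Step.
End Trees.

(** * The sum over collections *)

Section TreeSum.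
Variables (n : nat) (d : 'I_n -> nat).
Hypothesis d_gt0 : forall i, (0 < d i)%N.
Variable C : numClosedFieldType.
Local Notation N := #|{: cell d}|.
Local Notation bf := (bfilling d).
Local Notation node := (seq_sub (nodes d)).
Implicit Types (A B : filling d) (Bc : collection d) (w : seq nat) (p : {mpoly C[N]}).

(** The expansion of the coefficient of A over the collections cut at level m,
    where the coefficients of the level m resultant remain. *)
Definition tree_sum m p A : C :=
  \sum_(Bc : collection d | level_ok m Bc && (lookup Bc [::] == A))
    ratr (Wprod m Bc) * \prod_(w <- words d m) coef p (lookup Bc w).

Lemma words0 : words d 0 = [:: [::]].
Proof. by rewrite /words take0. Qed.

Lemma tree_sum0 p (A : bf) : (0 < n)%N -> REF 0 A -> tree_sum 0 p A = coef p A.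
Proof.
move=> n0 RA.
have nilN : [::] \in nodes d by rewrite mem_nodes n0; apply/forallP.
pose B0 : collection d := [ffun u : node => if val u == [::] then A else zero_bfilling d].
have B0nil : lookup B0 [::] = A.
  by rewrite lookupE /node_filling (insubT (fun w => w \in nodes d) nilN) ffunE.
rewrite /tree_sum (big_pred1 B0) => [|Bc /=].
  have -> : Wprod 0 B0 = 1 by rewrite /Wprod big_pred0.
  by rewrite rmorph1 mul1r words0 big_seq1 B0nil.
apply/andP/eqP => [[ok /eqP BcA]|->].
  apply/ffunP => u; rewrite ffunE; have /forallP/(_ u) := ok.
  rewrite leqn0 size_eq0; case: (val u =P [::]) => [u0 _|_ /eqP //].
  by apply: fil_inj; rewrite -BcA lookupE -u0 node_filling_val.
split; last by rewrite B0nil.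
apply/forallP => u; rewrite ffunE leqn0 size_eq0; case: (val u =P [::]) => [->|] //.
Qed.

Lemma coef_lookup_Wcoef (L : 'I_n) p p' Bc (u : node) : (L.+1 < n)%N ->
  is_res L p -> is_res L.+1 p' ->
  (forall a, p.@[point (pure_row L a)] = p'.@[point a] ^+ d L) ->
  level_ok L Bc -> size (val u) == L ->
  coef p (lookup Bc (val u)) =
  \sum_(Bs : {ffun 'I_(d L) -> bf} | Bs \in ffun_on (fun X : bf => REF L.+1 X))
    ratr (Wcoef (lookup Bc (val u)) (fun j => fil (Bs j))) * \prod_j coef p' (Bs j).
Proof.
move=> Ln pR pR' red ok /eqP uL; rewrite lookupE node_filling_val.
apply: (coef_Wcoef d_gt0 Ln pR pR' red).
by rewrite -uL; apply: (level_okP ok); rewrite uL.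
Qed.

(** Replace each coefficient at level L with its expansion and distribute the
    product over the words of length L. *)
Lemma tree_sum_step (L : 'I_n) p p' A : (L.+1 < n)%N ->
  is_res L p -> is_res L.+1 p' ->
  (forall a, p.@[point (pure_row L a)] = p'.@[point a] ^+ d L) ->
  tree_sum L p A = tree_sum L.+1 p' A.
Proof.
move=> Ln pR pR' red; pose zero_children : {ffun 'I_(d L) -> bf} := [ffun=> zero_bfilling d].
pose T (Bc : collection d) (f : {ffun node -> {ffun 'I_(d L) -> bf}}) : C :=
  ratr (Wprod L Bc) * \prod_(u : node | size (val u) == L)
    (ratr (Wcoef (lookup Bc (val u)) (fun j => fil (f u j))) * \prod_j coef p' (f u j)).
transitivity (\sum_(Bc : collection d | level_ok L Bc && (lookup Bc [::] == A))
  \sum_(f in pfamily zero_children (fun u : node => size (val u) == L)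
        (fun=> ffun_on (fun X : bf => REF L.+1 X))) T Bc f).
  apply: eq_bigr => Bc /andP[ok _]; rewrite prod_words //.
  rewrite (eq_bigr _ (fun u => @coef_lookup_Wcoef L p p' Bc u Ln pR pR' red ok)).
  by rewrite (big_distr_big_dep zero_children) big_distrr.
rewrite pair_big_dep /=.
rewrite (reindex_onto (fun Bc => (cut L Bc, children L Bc)) (fun q => graft d_gt0 q.1 q.2)) /=;
  last first.
  move=> [Bc f] /= /andP[/andP[ok _] /pfamilyP[fs _]].
  rewrite cut_graft // children_graft // => [u uL].
  apply/eqP; apply: contraR uL => fu; move/subsetP/(_ u): fs; apply.
  by rewrite inE.
apply: eq_big => [Bc|Bc].
  rewrite lookup_cut // (level_ok_children d_gt0 Ln Bc).
  by case: (level_ok L _); case: (lookup _ _ == _); case: (_ \in _); rewrite //= ?andbF ?andbT.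
move=> /andP[/andP[/andP[ok _] _] /eqP gr];
  rewrite /T WprodS rmorphM rmorph_prod Wprod_cut /= -[RHS]mulrA.
congr (_ * _); rewrite big_split /=; congr (_ * _).
  rewrite prod_words //; apply: eq_bigr => u /eqP uL; rewrite lookup_cut ?uL //.
  congr (ratr (Wcoef _ _)); apply: funext => j.
  by rewrite ffunE uL eqxx ffunE lookupE.
rewrite words_rcons big_allpairs_dep prod_words //; apply: eq_bigr => u /eqP uL.
rewrite (eq_bigr (fun j : 'I_(d L) => coef p' (lookup Bc (rcons (val u) j)))).
  by rewrite -(big_mkord xpredT (fun j => coef p' (lookup Bc (rcons (val u) j)))) /index_iota subn0.
by move=> j _; rewrite ffunE uL eqxx ffunE lookupE.
Qed.

(** With one variable left, REF has one element, and the value at the pure power is 1. *)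
Lemma coef_last (L : 'I_n) p A : L.+1 = n -> is_res L p -> REF L A -> coef p A = 1.
Proof.
move=> Ln pR RA.
have supp_pure (B : filling d) c : REF L B -> c != pure_cell d L -> B c = 0.
  move=> RB cp; apply: (REF_supp0 RB); apply: contra cp => cD.
  have cL : row_of c = L.
    by apply: val_inj; apply/eqP; rewrite eqn_leq (Dset_row cD) andbT -ltnS Ln ltn_ord.
  rewrite -cL -is_pureP /is_pure; apply/eqP/expo_single; rewrite -mdeg_expo mdegE.
  rewrite (bigD1 (row_of c)) //= big1 ?addn0 // => j jc; apply: (Dset_expo cD).
  by rewrite ltn_neqAle -ltnS Ln ltn_ord andbT -cL val_eqE.
have A_uniq (B : filling d) : REF L B -> B = A.
  move=> RB; apply/ffunP => c; have [->|cp] := eqVneq c (pure_cell d L); last by rewrite !supp_pure.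
  have row_pure (B' : filling d) : REF L B' -> B' (pure_cell d L) = (delta d L L)%:Z.
    move=> RB'; rewrite -(REF_row L RB') /frow (bigD1 (pure_cell d L)) //= big1 ?addr0 //.
    by move=> c' /andP[_]; apply: supp_pure.
  by rewrite !row_pure.
have [B AB] := REF_bfilling d_gt0 RA.
case: (pR) => _ _; rewrite (meval_res d_gt0 _ pR) (bigD1 B) /=; last by rewrite -AB.
rewrite [X in _ + X]big1 ?addr0 => [|B' /andP[RB' /eqP[]]]; last first.
  by apply: fil_inj; rewrite -AB; apply: A_uniq.
rewrite -AB big1 ?mulr1 // => c _; rewrite /point enum_rankK /pure is_pureP.
case: eqP => [_|cp]; first by rewrite expr1n.
by rewrite supp_pure //; apply/eqP => E; apply: cp; rewrite E row_mkcell.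
Qed.

Lemma coef_tree_sum p0 m : is_res 0 p0 -> (m < n)%N -> exists2 p, is_res m p &
  forall A : bf, REF 0 A -> coef p0 A = tree_sum m p A.
Proof.
move=> p0R; elim: m => [|m IH] mn.
  by exists p0 => // A RA; rewrite tree_sum0.
have [p pR p0E] := IH (ltnW mn).
have [p' pR' red] := @res_descent C n d d_gt0 (Ordinal (ltnW mn)) p pR mn.
exists p' => // A RA; rewrite p0E //.
exact: (@tree_sum_step (Ordinal (ltnW mn)) p p' A mn pR pR' red).
Qed.

Lemma coef_rcoef p0 (A : bf) : (0 < n)%N -> is_res 0 p0 -> REF 0 A ->
  coef p0 A = ratr (rcoef A).
Proof.
move=> n_gt0 p0R RA; have n1 : (n.-1 < n)%N by rewrite prednK.
have [p pR ->//] := coef_tree_sum p0R n1.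
rewrite /tree_sum /rcoef rmorph_sum.
have level_all Bc : level_ok n.-1 Bc = [forall w : node, REF (size (val w)) (Bc w)].
  apply: eq_forallb => u; have := valP u; rewrite mem_nodes => /andP[un _].
  by rewrite ifT // -ltnS prednK.
apply: eq_big => [Bc|Bc /andP[ok _]]; first by rewrite level_all.
rewrite big_seq big1 ?mulr1 => [|w].
  congr (ratr _); rewrite /Wprod; apply: eq_bigl => l.
  by rewrite -ltnS prednK.
rewrite mem_words_nodes // => /andP[wN /eqP wn].
apply: (@coef_last (Ordinal n1)) => //=; first by rewrite prednK.
rewrite lookupE (_ : w = val (SeqSub wN)) // node_filling_val -{1}wn.
by apply: (level_okP ok); rewrite /= wn.
Qed.

End TreeSum.

Lemma is_resultant_is_res (R : realType) n (d : 'I_n -> nat)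
    (p : {mpoly R[i][#|{: cell d}|]}) :
  is_resultant p -> is_res (C := R[i]%C) 0 p.
Proof.
move=> [pz p_row p1].
have form_eval (a : cell d -> R[i]%C) i x : (Defs.form a i).@[x] = formv a i x.
  rewrite /Defs.form raddf_sum; apply: eq_bigr => c _.
  by rewrite /= mevalZ mevalX.
split=> [a|i m _ mp|].
- rewrite -[p.@[_]]/(eval_coef p a) pz; split.
    by move=> [x [xn0 ax]]; exists x; split=> // i _; rewrite -form_eval.
  by move=> [x [xn0 _ ax]]; exists x; split=> // i; rewrite form_eval ax.
- by rewrite (p_row i m mp) /delta leq0n; apply: eq_bigl => j.
apply: p1 => i; apply: mpoly_eq_fun => x; rewrite form_eval formv_pure_row //.
by rewrite rmorphXn /= mevalXU.
Qed.

Theorem theorem5p1 (R : realType) (n : nat) (d : 'I_n -> nat)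
    (n_gt0 : (0 < n)%N) (d_gt0 : forall i, (0 < d i)%N)
    (Res : {mpoly R[i][#|{: cell d}|]}) (Res_resultant : is_resultant Res) :
  Res = \sum_(A : bfilling d | REF 0 A) ratr (rcoef A) *: fmonom R A.
Proof.
have ResR := is_resultant_is_res Res_resultant.
rewrite [LHS](res_expand d_gt0 ResR); apply: eq_bigr => A RA.
by rewrite fmonomE coef_rcoef.
Qed.
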